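(* Let $(\mathcal{S},\mathcal{F})$ satisfy Assumptions A0, A1, A2 and A3. Then there exists a constant $C\ge1$ such that for any $x_0\in\mathbb{R}^n\setminus\{0\}$ there exists a trajectory $x:t\mapsto\Phi_A(t,0)x_0$, with $A$ belonging to the weak-$\star$ closure of $\mathcal{F}_\infty$, such that, for every $t\ge0$, $$\frac1C\,\rho(\mathcal{S})^t\|x_0\|\le\|x(t)\|\le C\,\rho(\mathcal{S})^t\|x_0\|.$$
   Context: $\mathscr{M}\subset M_n(\mathbb{R})$ is a bounded nonempty set of matrices, $L_\infty(I,\mathscr{M})$ denotes the measurable functions $I\to\mathscr{M}$, and $\mathcal{S}\subset L_\infty([0,\infty),\mathscr{M})$ is a nonempty class of switching laws. $\|\cdot\|$ is a norm on $\mathbb{R}^n$ and the induced operator norm. $\Phi_A(t,s)$ is the flow (fundamental matrix) of $\dot x=A(\cdot)x$ from time $s$ to time $t$. The concatenation $A_1\ast A_2$ of signals on $[0,t_1]$, $[0,t_2]$ equals $A_1$ on $[0,t_1]$ and $A_2(\cdot-t_1)$ on $(t_1,t_1+t_2]$ (similarly for infinite concatenations and sets of signals). $\mathcal{F}=\cup_{t\ge0}\mathcal{F}_t$ with $\mathcal{F}_t\subset L_\infty([0,t],\mathscr{M})$; $\mathcal{F}_\infty=\{A_1\ast A_2\ast\cdots\mid A_k\in\mathcal{F}_{t_k},\ \sum_k t_k=\infty\}$; $\Phi(\mathcal{F}_t)=\{\Phi_A(t,0)\mid A\in\mathcal{F}_t\}$, $\Phi(\mathcal{F})=\cup_{t\ge0}\Phi(\mathcal{F}_t)$.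 The weak-$\star$ closure of $\mathcal{F}_\infty$ is taken in $L_\infty([0,\infty),M_n(\mathbb{R}))$ (dual of $L_1$). $\rho(\mathcal{S})=\limsup_{t\to+\infty}\sup_{A\in\mathcal{S}}\|\Phi_A(t,0)\|^{1/t}$. Assumptions: - A0 (shift-invariance): $A(t+\cdot)\in\mathcal{S}$ for every $A\in\mathcal{S}$, $t\ge0$. - A1 (concatenability): $\mathcal{F}_s\ast\mathcal{F}_t\subset\mathcal{F}_{s+t}$ for every $s,t\ge0$. - A2 (irreducibility): $\Phi(\mathcal{F})$ is irreducible, i.e., the only subspaces of $\mathbb{R}^n$ invariant under every element of $\Phi(\mathcal{F})$ are $\{0\}$ and $\mathbb{R}^n$. - A3 (fatness): $\mathcal{F}_\infty\subset\mathcal{S}$ and there exist constants $C,\Delta\ge0$ and a compact $\mathscr{K}\subset\mathrm{GL}(n)$ such that for every $t\ge0$ and $A\in\mathcal{S}$ there exist $K\in\mathscr{K}$, $\hat t\in[t,t+\Delta]$ and $R\in\Phi(\mathcal{F}_{\hat t})$ with $\|\Phi_A(t,0)KR^{-1}\|\le C$; moreover, if $A\in\mathcal{F}_\infty$, one can take $K=\mathrm{Id}_n$. *)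

(* Defs.v *)
From HB Require Import structures.
From mathcomp Require Import all_boot all_order all_algebra.
From mathcomp Require Import all_classical all_reals all_analysis.

Set Implicit Arguments.
Unset Strict Implicit.
Unset Printing Implicit Defensive.

Import Order.TTheory GRing.Theory Num.Theory.
Import numFieldNormedType.Exports.

Local Open Scope classical_set_scope.
Local Open Scope ring_scope.

Definition is_norm (R : realType) (n : nat) (N : 'cV[R]_n -> R) : Prop :=
  [/\ forall x y, N (x + y) <= N x + N y,
      forall a x, N (a *: x) = `|a| * N x &
      forall x, N x = 0 -> x = 0].

Definition opnorm (R : realType) (n : nat) (N : 'cV[R]_n -> R) (P : 'M[R]_n) : R :=
  sup [set N (P *m x) | x in [set x | N x <= 1]].

(* A function on an interval I of [0, +oo[ is encoded by its extension by 0 to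
   the whole line, which is a bijection. Functions are not identified when they
   agree almost everywhere: a set of classes is represented by the set of all
   the members of these classes. *)
Notation signal R n := (R -> 'M[R]_n) (only parsing).

(* The elements of L_oo(I, M). Essential boundedness follows from the other
   clauses when M is bounded; it is needed for M = setT. *)
Definition Linfty (R : realType) (n : nat) (I : set R) (M : set 'M[R]_n) :
    set (signal R n) :=
  [set A : signal R n | [/\ forall i j, measurable_fun I (fun t => A t i j),
               exists c : R, \forall t \ae lebesgue_measure, I t -> `|A t| <= c,
               forall t, I t -> M (A t) &
               forall t, ~ I t -> A t = 0]].

Definition L1 (R : realType) (n : nat) (I : set R) : set (signal R n) :=
  [set f : signal R n | forall i j, lebesgue_measure.-integrable I (EFin \o (fun t => f t i j))].

(* Caratheodory solution on [s, t] of X' = A X, X(s) = Id, in integral form. *)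
Definition fundamental_solution (R : realType) (n : nat) (A : signal R n)
    (s t : R) (X : R -> 'M[R]_n) : Prop :=
  {within `[s, t], continuous X} /\
  forall r, s <= r <= t ->
    X r = 1%:M + \matrix_(i, j)
            (\int[lebesgue_measure]_(u in `[s, r]) (A u *m X u) i j).

(* Phi_A(t, s), for s <= t. The set below is a singleton as soon as A is
   measurable and essentially bounded on [s, t]; 0 is a dummy default. *)
Definition flow (R : realType) (n : nat) (A : signal R n) (t s : R) : 'M[R]_n :=
  xget 0 [set P | exists2 X, fundamental_solution A s t X & X t = P].

Definition shift (R : realType) (n : nat) (t : R) (A : signal R n) : signal R n :=
  fun s => if 0 <= s then A (t + s) else 0.

(* Since A1 vanishes on ]-oo, 0[ and A2 on ]t2, +oo[, this vanishes off
   [0, t1 + t2]. *)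
Definition concat (R : realType) (n : nat) (t1 : R) (A1 A2 : signal R n) :
    signal R n :=
  fun s => if s <= t1 then A1 s else A2 (s - t1).

(* A is a 0 * a 1 * a 2 * ..., where a k has duration tau k; the junction times
   are series tau k = \sum_(i < k) tau i. The first clause carries the value
   at 0 and the extension by 0 to negative times. *)
Definition is_infinite_concat (R : realType) (n : nat) (tau : nat -> R)
    (a : nat -> signal R n) (A : signal R n) : Prop :=
  (forall s, s <= 0 -> A s = a 0%N s) /\
  (forall k s, series tau k < s <= series tau k.+1 ->
     A s = a k (s - series tau k)).

(* Families (F_t) are indexed by all real t; only t >= 0 is ever used. *)
Definition infinite_concats (R : realType) (n : nat) (F : R -> set (signal R n)) :
    set (signal R n) :=
  [set A : signal R n | exists tau : nat -> R, exists a : nat -> signal R n,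
     [/\ forall k, 0 <= tau k /\ F (tau k) (a k),
         series tau @ \oo --> +oo &
         is_infinite_concat tau a A]].

(* Phi(F_t) *)
Definition flows_at (R : realType) (n : nat) (F : R -> set (signal R n)) (t : R) :
    set 'M[R]_n :=
  [set flow A t 0 | A in F t].

(* Phi(F) *)
Definition flows (R : realType) (n : nat) (F : R -> set (signal R n)) :
    set 'M[R]_n :=
  \bigcup_(t in `[0, +oo[) flows_at F t.

(* The limsup is finite when the signals of S are uniformly bounded, so that
   fine loses nothing. *)
Definition rho (R : realType) (n : nat) (N : 'cV[R]_n -> R)
    (S : set (signal R n)) : R :=
  fine (limf_esup (fun t : R =>
    ereal_sup [set ((opnorm N (flow A t 0)) `^ t^-1)%:E | A in S]) +oo).

Definition shift_invariant (R : realType) (n : nat) (S : set (signal R n)) : Prop :=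
  forall A t, S A -> 0 <= t -> S (shift t A).

Definition concatenable (R : realType) (n : nat) (F : R -> set (signal R n)) : Prop :=
  forall s t A1 A2, 0 <= s -> 0 <= t -> F s A1 -> F t A2 ->
    F (s + t) (concat s A1 A2).

Definition irreducible (R : realType) (n : nat) (Ps : set 'M[R]_n) : Prop :=
  forall U : {vspace 'cV[R]_n},
    (forall P x, Ps P -> x \in U -> P *m x \in U) -> U = 0%VS \/ U = fullv.

Definition fat (R : realType) (n : nat) (N : 'cV[R]_n -> R)
    (S : set (signal R n)) (F : R -> set (signal R n)) : Prop :=
  infinite_concats F `<=` S /\
  exists (C Delta : R) (Ks : set 'M[R]_n),
    [/\ 0 <= C, 0 <= Delta, compact Ks, forall K, Ks K -> K \in unitmx &
        forall t A, 0 <= t -> S A ->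
          exists K that Q,
            [/\ Ks K, t <= that <= t + Delta, flows_at F that Q,
                opnorm N (flow A t 0 *m K *m invmx Q) <= C &
                infinite_concats F A -> K = 1%:M]].

(* The duality between L_oo([0, +oo[, M_n(R)) and L_1([0, +oo[, M_n(R)). *)
Definition pairing (R : realType) (n : nat) (A : signal R n) :
    {ptws {f : signal R n | L1 `[0, +oo[ f} -> R} :=
  fun f => \int[lebesgue_measure]_(t in `[0, +oo[) \tr ((sval f t)^T *m A t).

(* The weak-* topology of L_oo([0, +oo[, M_n(R)) is the trace on this set of the
   initial topology for the pairing. *)
Definition weakstar_closure (R : realType) (n : nat) (E : set (signal R n)) :
    set (signal R n) :=
  Linfty `[0, +oo[ setT `&` closure (E : set (initial_topology (@pairing R n))).

(* Main.v *)
(* Let [rho] be the growth rate and let an irreducible semigroup of flows be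
   given. By irreducibility and compactness of the unit spheres, there are
   [T] and [d > 0] such that for all [Q] and [x] some [P] in [flows F], of
   duration at most [T], satisfies [d |Q| |x| <= |Q P x|]. Inserting such
   factors between the factors of [Q ^ j] shows that [|Q| <= C rho ^ t] on
   [flows_at F t]; by fatness the same bound holds for all signals of [S].
   Conversely, by submultiplicativity of the supremum over [S] some signal of
   [S] satisfies [|Phi_A(T, 0)| >= rho ^ T / const]; fatness and the choice of
   [P] give from it a signal of [F_oo] whose trajectory from [x] has length at
   least [const rho ^ T |x|] near time [T], hence, by the upper bound on
   [[t, T]] and shift-invariance, at least [const rho ^ t |x|] at every
   [t <= T]. Finally one lets [T] tend to infinity: bounded sets of signals are
   weak-* compact and flows are weak-* continuous.

   All compactness arguments use limits along a fixed free ultrafilter on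
   [nat]; the weak-* limit of a sequence of signals is obtained as the
   Radon-Nikodym density of the limit of the integrals. *)

Require Import Defs.
From HB Require Import structures.
From mathcomp Require Import all_boot all_order all_algebra.
From mathcomp Require Import all_classical all_reals all_analysis.
From mathcomp Require Import measurable_realfun.
From mathcomp Require Import lra ring.

Set Implicit Arguments.
Unset Strict Implicit.
Unset Printing Implicit Defensive.

Import Order.TTheory GRing.Theory Num.Theory.
Import numFieldNormedType.Exports.

Local Open Scope classical_set_scope.
Local Open Scope ring_scope.

(** * Norms and ultrafilter limits *)

(** Three obstacles shape the proof. The equation [X' = A X] multiplies two factors that both vary
    with the signal, and weak-* convergence does not pass through products. It does here because
    trajectories of signals with a common bound [c] are equi-Lipschitz on bounded intervals: they
    converge uniformly, and a weak limit may be multiplied by a strong one. Since the weak-* limit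
    may take values outside [M], all facts on differential equations concern signals known only to
    be bounded by [c]. Next, the lower bound needs a constant free of the horizon [T]. Losses occur
    only in finitely many matrix inequalities and over a time window whose length is bounded by the
    constants of fatness and of irreducibility, so none of them grows with [T]. Finally, the limit
    of the integrals must be a finite charge, although Lebesgue measure of the line is infinite. The
    integrals are therefore weighted by the Gaussian density, which is divided out of the
    Radon-Nikodym density afterwards. *)

Section MatrixNorm.
Variable R : realType.

Lemma mx_norm_le m n (X : 'M[R]_(m, n)) (c : R) :
  0 <= c -> (forall i j, `|X i j| <= c) -> `|X| <= c.
Proof.
move=> c0 Xc; rewrite /Num.Def.normr /= mx_normrE.
by apply: bigmax_le => // -[i j] _; exact: Xc.
Qed.

Lemma mx_norm_entry m n (X : 'M[R]_(m, n)) i j : `|X i j| <= `|X|.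
Proof.
rewrite [leRHS]/Num.Def.normr /= mx_normrE.
exact: (le_bigmax _ (fun ij : 'I_m * 'I_n => `|X ij.1 ij.2|) (i, j)).
Qed.

Lemma mx_norm_mul m n p (A : 'M[R]_(m, n)) (B : 'M[R]_(n, p)) :
  `|A *m B| <= n%:R * `|A| * `|B|.
Proof.
apply: mx_norm_le => [|i j]; first by rewrite !mulr_ge0.
rewrite mxE (le_trans (ler_norm_sum _ _ _))//.
have -> : n%:R * `|A| * `|B| = \sum_(k < n) `|A| * `|B|.
  by rewrite sumr_const card_ord -mulrA mulr_natl.
apply: ler_sum => k _; rewrite normrM.
by apply: ler_pM => //; exact: mx_norm_entry.
Qed.

Lemma mx_norm1 n : `|1%:M : 'M[R]_n| <= 1.
Proof.
by apply: mx_norm_le => // i j; rewrite mxE; case: eqP; rewrite ?normr1 ?normr0.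
Qed.

Lemma mx_cvg (T : Type) (F : set_system T) {FF : Filter F} m n
    (x : T -> 'M[R]_(m, n)) (L : 'M[R]_(m, n)) :
  (forall i j, x k i j @[k --> F] --> L i j) -> x @ F --> L.
Proof.
move=> xL; apply/cvgrPdist_le => e e0.
have : \forall k \near F, forall ij : 'I_m * 'I_n,
    `|L ij.1 ij.2 - x k ij.1 ij.2| <= e.
  by apply: filter_forall => -[i j]; move/cvgrPdist_le : (xL i j); exact.
apply: filterS => k xk; apply: mx_norm_le => [|i j]; first exact: ltW.
by rewrite !mxE; exact: (xk (i, j)).
Qed.

Lemma cvg_mx_entry (T : Type) (F : set_system T) {FF : Filter F} m n
    (x : T -> 'M[R]_(m, n)) (L : 'M[R]_(m, n)) i j :
  x @ F --> L -> x k i j @[k --> F] --> L i j.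
Proof.
move=> xL; apply: (@cvg_comp _ _ _ x (fun M : 'M[R]_(m, n) => M i j) _ _ _ xL).
exact: coord_continuous.
Qed.

Lemma cvg_mulmx (T : Type) (F : set_system T) {FF : Filter F} m n p
    (x : T -> 'M[R]_(m, n)) (y : T -> 'M[R]_(n, p))
    (L : 'M[R]_(m, n)) (K : 'M[R]_(n, p)) :
  x @ F --> L -> y @ F --> K -> (x k *m y k) @[k --> F] --> L *m K.
Proof.
move=> xL yK; apply: mx_cvg => i j; rewrite mxE.
under eq_fun do rewrite mxE.
apply: cvg_big => [|k _]; first exact: add_continuous.
by apply: cvgM; exact: cvg_mx_entry.
Qed.

End MatrixNorm.

Section UltraLimit.
Variables (R : realType) (U : set_system nat).
Context {UU : UltraFilter U}.

(** Compactness of the segment gives a cluster point. For an ultrafilter it is a limit: if the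
    preimage of a neighbourhood were not in [U], that of its complement would be, and the two are
    disjoint. *)
Lemma ultra_cvg_real (u : nat -> R) (c : R) :
  (forall k, `|u k| <= c) -> exists l : R, u @ U --> l.
Proof.
move=> uc.
have uU : \forall k \near U, `[- c, c]%classic (u k).
  by apply: nearW => k; rewrite /= in_itv /= -ler_norml.
have [p [_ clp]] := @segment_compact R (- c) c (u @ U) _ uU.
exists p => A Ap /=.
have [//|UnA] := in_ultra_setVsetC (u @^-1` A) UU.
by have [x []] := clp (~` A) A UnA Ap.
Qed.

Lemma ultra_cvg_mx m n (x : nat -> 'M[R]_(m, n)) (c : R) :
  (forall k, `|x k| <= c) -> exists L : 'M[R]_(m, n), x @ U --> L.
Proof.
move=> xc.
have /choice[f fP] : forall ij : 'I_m * 'I_n,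
    exists l : R, x k ij.1 ij.2 @[k --> U] --> l.
  move=> [i j]; apply: (@ultra_cvg_real _ c) => k.
  exact: le_trans (mx_norm_entry _ _ _) (xc k).
exists (\matrix_(i, j) f (i, j)); apply: mx_cvg => i j.
by rewrite mxE; exact: (fP (i, j)).
Qed.

End UltraLimit.

Lemma free_ultrafilter : exists U : set_system nat,
  UltraFilter U /\ (\oo : set_system nat) `<=` U.
Proof. exact: ultraFilterLemma. Qed.

(** * Scalar Lebesgue integrals *)

Section RealIntegrable.
Variable R : realType.
Local Notation mu := (@lebesgue_measure R).
Variables (D : set R) (mD : measurable D).
Implicit Types f g : R -> R.

Lemma RintegrableZ (c : R) f : mu.-integrable D (EFin \o f) ->
  mu.-integrable D (EFin \o (fun t => c * f t)).
Proof. by move=> fi; exact: (@integrableZl _ _ _ mu D mD c (EFin \o f) fi). Qed.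

Lemma RintegrableN f : mu.-integrable D (EFin \o f) ->
  mu.-integrable D (EFin \o (fun t => - f t)).
Proof. by move=> fi; exact: (integrableN fi). Qed.

Lemma RintegrableD f g : mu.-integrable D (EFin \o f) ->
  mu.-integrable D (EFin \o g) ->
  mu.-integrable D (EFin \o (fun t => f t + g t)).
Proof. by move=> fi gi; exact: (@integrableD _ _ _ mu D mD (EFin \o f) (EFin \o g) fi gi). Qed.

Lemma RintegrableB f g : mu.-integrable D (EFin \o f) ->
  mu.-integrable D (EFin \o g) ->
  mu.-integrable D (EFin \o (fun t => f t - g t)).
Proof. by move=> fi gi; exact: (@integrableB _ _ _ mu D mD (EFin \o f) (EFin \o g) fi gi). Qed.

Lemma Rintegrable_mulb f g (c : R) : mu.-integrable D (EFin \o f) ->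
  measurable_fun D g -> (forall t, D t -> `|g t| <= c) ->
  mu.-integrable D (EFin \o (fun t => f t * g t)).
Proof.
move=> fi mg gc.
have mf : measurable_fun D f by apply/measurable_EFinP; exact: measurable_int fi.
apply: (@le_integrable _ _ _ mu D mD _ (EFin \o (fun t => c * `|f t|))); last first.
- exact: (RintegrableZ c (integrable_norm fi)).
- move=> t Dt /=; rewrite lee_fin normrM [leRHS]normrM normr_id mulrC.
  by rewrite ler_wpM2r// (le_trans (gc _ Dt))// ler_norm.
- by apply/measurable_EFinP; exact: measurable_funM.
Qed.

Lemma RintegralN f : mu.-integrable D (EFin \o f) ->
  \int[mu]_(t in D) (- f t) = - \int[mu]_(t in D) f t.
Proof.
move=> fi; rewrite -mulN1r -RintegralZl//.
by apply: eq_Rintegral => t _; rewrite mulN1r.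
Qed.

Lemma Rintegral_le_bound f g : mu.-integrable D (EFin \o f) ->
  mu.-integrable D (EFin \o g) -> (forall t, D t -> `|f t| <= g t) ->
  `|\int[mu]_(t in D) f t| <= \int[mu]_(t in D) g t.
Proof.
move=> fi gi fg; rewrite (le_trans (@le_normr_Rintegral _ _ R mu D f mD fi))//.
by apply: le_Rintegral => //; exact: integrable_norm.
Qed.

End RealIntegrable.

(** * Integrals of matrix-valued functions *)

Section MatrixIntegral.
Variable R : realType.
Local Notation mu := (@lebesgue_measure R).

(** On a segment this implies integrability of the entries and, unlike integrability, it is stable
    under products. *)
Definition bounded_measurable m n (D : set R) (X : R -> 'M[R]_(m, n)) :=
  (forall i j, measurable_fun D (fun t => X t i j)) /\
  exists c : R, forall t, D t -> `|X t| <= c.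

Definition mxint m n (D : set R) (X : R -> 'M[R]_(m, n)) : 'M[R]_(m, n) :=
  \matrix_(i, j) \int[mu]_(t in D) X t i j.

Lemma bounded_measurableS m n (D E : set R) (X : R -> 'M[R]_(m, n)) :
  measurable D -> E `<=` D ->
  bounded_measurable D X -> bounded_measurable E X.
Proof.
move=> mD ED [mX [c Xc]]; split; last by exists c => t /ED; exact: Xc.
by move=> i j; apply: measurable_funS (mX i j).
Qed.

Lemma bounded_measurable_cst m n (D : set R) (P : 'M[R]_(m, n)) :
  bounded_measurable D (fun=> P).
Proof. by split=> [i j|]; [exact: measurable_cst|exists `|P|]. Qed.

Lemma bounded_measurableB m n (D : set R) (X Y : R -> 'M[R]_(m, n)) :
  bounded_measurable D X -> bounded_measurable D Y ->
  bounded_measurable D (fun t => X t - Y t).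
Proof.
move=> [mX [c Xc]] [mY [d Yd]]; split=> [i j|].
  rewrite (_ : (fun t => _) = (fun t => X t i j - Y t i j)).
    exact: measurable_funB.
  by apply/funext => t; rewrite !mxE.
exists (c + d) => t Dt; rewrite (le_trans (ler_normB _ _))// lerD//.
  exact: Xc.
exact: Yd.
Qed.

Lemma bounded_measurableM m n p (D : set R) (X : R -> 'M[R]_(m, n))
    (Y : R -> 'M[R]_(n, p)) :
  bounded_measurable D X -> bounded_measurable D Y ->
  bounded_measurable D (fun t => X t *m Y t).
Proof.
move=> [mX [c Xc]] [mY [d Yd]]; split=> [i j|].
  rewrite (_ : (fun t => _) = (fun t => \sum_(l < n) X t i l * Y t l j)).
    by apply: measurable_sum => l; exact: measurable_funM.
  by apply/funext => t; rewrite mxE.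
exists (n%:R * c * d) => t Dt; rewrite (le_trans (mx_norm_mul _ _))//.
by apply: ler_pM => //; [rewrite ler_wpM2l// Xc|exact: Yd].
Qed.

Lemma bounded_measurable_integrable m n (a b : R) (X : R -> 'M[R]_(m, n)) i j :
  bounded_measurable `[a, b] X ->
  mu.-integrable `[a, b] (EFin \o (fun t => X t i j)).
Proof.
move=> [mX [c Xc]].
have ic : mu.-integrable `[a, b] (EFin \o (fun=> 1 : R)).
  apply: continuous_compact_integrable; first exact: segment_compact.
  by apply: continuous_subspaceT; exact: cst_continuous.
have := @Rintegrable_mulb R `[a, b]%classic (measurable_itv _) (fun=> 1)
  (fun t => X t i j) c ic (mX i j).
have -> : (fun t => 1 * X t i j) = (fun t => X t i j).
  by apply/funext => t; rewrite mul1r.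
by apply=> t Dt; rewrite (le_trans (mx_norm_entry _ _ _))// Xc.
Qed.

Lemma eq_mxint m n (D : set R) (X Y : R -> 'M[R]_(m, n)) :
  (forall t, D t -> X t = Y t) -> mxint D X = mxint D Y.
Proof.
move=> XY; apply/matrixP => i j; rewrite !mxE.
by apply: eq_Rintegral => t /set_mem Dt; rewrite XY.
Qed.

Lemma mxintB m n (a b : R) (X Y : R -> 'M[R]_(m, n)) :
  bounded_measurable `[a, b] X -> bounded_measurable `[a, b] Y ->
  mxint `[a, b] (fun t => X t - Y t) = mxint `[a, b] X - mxint `[a, b] Y.
Proof.
move=> bX bY; apply/matrixP => i j; rewrite !mxE -RintegralB//.
- by apply: eq_Rintegral => t _; rewrite !mxE.
- exact: bounded_measurable_integrable.
- exact: bounded_measurable_integrable.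
Qed.

Lemma Rintegrable_sum (I : Type) (s : seq I) (D : set R) (f : I -> R -> R) :
  measurable D -> (forall i, mu.-integrable D (EFin \o f i)) ->
  mu.-integrable D (EFin \o (fun t => \sum_(i <- s) f i t)).
Proof.
move=> mD fi; elim: s => [|i s ih].
  by under eq_fun do rewrite big_nil; exact: integrable0.
by under eq_fun do rewrite big_cons; exact: RintegrableD.
Qed.

Lemma Rintegral_sum (I : Type) (s : seq I) (D : set R) (f : I -> R -> R) :
  measurable D -> (forall i, mu.-integrable D (EFin \o f i)) ->
  \int[mu]_(t in D) (\sum_(i <- s) f i t) = \sum_(i <- s) \int[mu]_(t in D) f i t.
Proof.
move=> mD fi; elim: s => [|i s ih].
  by under eq_Rintegral do rewrite big_nil; rewrite big_nil /Rintegral integral0.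
under eq_Rintegral do rewrite big_cons.
by rewrite big_cons RintegralD ?ih//; exact: Rintegrable_sum.
Qed.

Lemma mxint_mulr m n p (a b : R) (X : R -> 'M[R]_(m, n)) (P : 'M[R]_(n, p)) :
  bounded_measurable `[a, b] X ->
  mxint `[a, b] (fun t => X t *m P) = mxint `[a, b] X *m P.
Proof.
move=> bX; apply/matrixP => i j; rewrite !mxE.
under eq_Rintegral do rewrite mxE.
rewrite Rintegral_sum//.
  apply: eq_bigr => l _; rewrite mxE RintegralZr//.
  exact: bounded_measurable_integrable.
move=> l.
rewrite (_ : (fun t => _) = (fun t => P l j * X t i l)); last first.
  by apply/funext => t; rewrite mulrC.
by apply: RintegrableZ => //; exact: bounded_measurable_integrable.
Qed.

Lemma mxint_split m n (a b c : R) (X : R -> 'M[R]_(m, n)) :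
  a <= b -> b <= c -> bounded_measurable `[a, c] X ->
  mxint `[a, c] X = mxint `[a, b] X + mxint `[b, c] X.
Proof.
move=> ab bc bX; apply/matrixP => i j; rewrite !mxE.
have Xi : mu.-integrable `[a, c] (EFin \o (fun t => X t i j)).
  exact: bounded_measurable_integrable.
have := @Rintegral_itvB R (fun t => X t i j) (BLeft a) (BRight c) b Xi.
rewrite !bnd_simp => /(_ ab bc).
rewrite Rintegral_itv_obnd_cbnd; first by move=> <-; rewrite addrC subrK.
by apply: integrableS Xi => //; apply: subset_itv; rewrite bnd_simp.
Qed.

Lemma mxint_norm_le m n (a b : R) (X : R -> 'M[R]_(m, n)) (g : R -> R) :
  bounded_measurable `[a, b] X -> mu.-integrable `[a, b] (EFin \o g) ->
  (forall t, a <= t <= b -> `|X t| <= g t) ->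
  `|mxint `[a, b] X| <= \int[mu]_(t in `[a, b]) g t.
Proof.
move=> bX gi Xg; apply: mx_norm_le => [|i j].
  apply: Rintegral_ge0 => t; rewrite /= in_itv/= => /Xg; exact: le_trans.
rewrite mxE; apply: Rintegral_le_bound => //.
  exact: bounded_measurable_integrable.
move=> t; rewrite /= in_itv/= => /Xg; apply: le_trans.
exact: mx_norm_entry.
Qed.

Lemma Rintegral_cst_itv (a b k : R) : a <= b ->
  \int[mu]_(t in `[a, b]) k = k * (b - a).
Proof.
move=> ab; rewrite Rintegral_cst//.
suff H : (mu `[a, b]%classic = (b - a)%:E)%E by move: H => /= ->.
rewrite lebesgue_measure_itv/= lte_fin.
by move: ab; rewrite le_eqVlt => /predU1P[->|->]; rewrite ?ltxx ?subrr.
Qed.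

Lemma integrable_cst_itv (a b k : R) :
  mu.-integrable `[a, b] (EFin \o (fun=> k)).
Proof.
have := @bounded_measurable_integrable 1 1 a b (fun=> k%:M) 0 0.
have -> : (fun t : R => (k%:M : 'M[R]_1) 0 0) = (fun=> k).
  by apply/funext => t; rewrite mxE eqxx.
by apply; exact: bounded_measurable_cst.
Qed.

Lemma mxint_norm_le_cst m n (a b k : R) (X : R -> 'M[R]_(m, n)) :
  a <= b -> bounded_measurable `[a, b] X ->
  (forall t, a <= t <= b -> `|X t| <= k) -> `|mxint `[a, b] X| <= k * (b - a).
Proof.
move=> ab bX Xk; rewrite -Rintegral_cst_itv//.
by apply: mxint_norm_le => //; exact: integrable_cst_itv.
Qed.

Lemma continuous_expR_scale (l : R) : continuous (fun t => expR (l * t)).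
Proof.
move=> t; apply: (@continuous_comp _ _ _ (fun t => l * t) expR).
  by apply: cvgM; [exact: cvg_cst|exact: cvg_id].
exact: continuous_expR.
Qed.

Lemma expR_scale_integrable (a b l : R) :
  mu.-integrable `[a, b] (EFin \o (fun t => expR (l * t))).
Proof.
apply: continuous_compact_integrable; first exact: segment_compact.
by apply: continuous_subspaceT; exact: continuous_expR_scale.
Qed.

Lemma Rintegral_expR_scale (a b l : R) : l != 0 -> a <= b ->
  \int[mu]_(t in `[a, b]) expR (l * t) = (expR (l * b) - expR (l * a)) / l.
Proof.
move=> l0; rewrite le_eqVlt => /predU1P[<-|ab].
  by rewrite set_itv1 Rintegral_set1 subrr mul0r.
have dF (t : R) : is_derive t 1 (fun t => expR (l * t) / l) (expR (l * t)).
  apply: is_derive_eq.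
  by rewrite scaler0 add0r /GRing.scale/= mulr1; field.
rewrite /Rintegral (@continuous_FTC2 _ _ (fun t => expR (l * t) / l))//.
- by rewrite -EFinB/= mulrBl.
- by apply: continuous_subspaceT; exact: continuous_expR_scale.
- split.
  + by move=> t _; exact: ex_derive.
  + apply: cvg_at_right_filter; apply: cvgM; last exact: cvg_cst.
    exact: continuous_expR_scale.
  + apply: cvg_at_left_filter; apply: cvgM; last exact: cvg_cst.
    exact: continuous_expR_scale.
- by move=> t _; rewrite derive1E; exact: derive_val.
Qed.

End MatrixIntegral.

(** * Linear differential equations *)

Section Solutions.
Variable R : realType.
Local Notation mu := (@lebesgue_measure R).

(* The hypothesis on [g] halves the excess of the constant in [g <= M w] over
   [2 b], hence iterating it leaves [2 b]. *)
Lemma weighted_absorption (D : set R) (g w : R -> R) (b B : R) :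
  0 <= b -> 0 <= B ->
  (forall u, D u -> 0 <= w u) -> (forall u, D u -> g u <= B * w u) ->
  (forall M, 0 <= M -> (forall u, D u -> g u <= M * w u) ->
     forall u, D u -> g u <= (b + M / 2) * w u) ->
  forall u, D u -> g u <= 2 * b * w u.
Proof.
move=> b0 B0 w0 gB step u Du.
have gk k v : D v -> g v <= (2 * b + B / 2 ^+ k) * w v.
  elim: k v => [|k ih] v Dv.
    rewrite expr0 divr1 (le_trans (gB v Dv))// ler_wpM2r ?w0// lerDr.
    by rewrite mulr_ge0.
  have M0 : 0 <= 2 * b + B / 2 ^+ k by rewrite addr_ge0// ?mulr_ge0.
  have := step _ M0 ih v Dv; congr (_ <= _ * _).
  rewrite exprS invfM; field.
  by rewrite expf_neq0.
rewrite leNgt; apply/negP => lt_g.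
have d0 : 0 < g u - 2 * b * w u by rewrite subr_gt0.
set d := g u - 2 * b * w u in d0.
have dk k : d * 2 ^+ k <= B * w u.
  rewrite -ler_pdivlMr ?exprn_gt0// /d lerBlDl (le_trans (gk k u Du))//.
  by rewrite mulrDl [B / _ * _]mulrAC.
have : (B * w u) / d < 2 ^+ Num.bound (B * w u / d).
  apply: (@lt_trans _ _ (Num.bound (B * w u / d))%:R).
    by rewrite archi_boundP// divr_ge0 ?mulr_ge0 ?w0// ltW.
  by rewrite -natrX ltr_nat ltn_expl.
by rewrite ltr_pdivrMr// ltNge mulrC dk.
Qed.

(** The bound holds everywhere and the domain is the whole line, in accordance with the extension of
    signals by 0. *)
Definition bounded_signal n (c : R) (A : R -> 'M[R]_n) :=
  (forall i j, measurable_fun setT (fun t => A t i j)) /\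
  forall t, `|A t| <= c.

Lemma bounded_signal_measurable n c (A : R -> 'M[R]_n) (D : set R) :
  measurable D -> bounded_signal c A -> bounded_measurable D A.
Proof.
move=> mD [mA Ac]; split; last by exists c => t _; exact: Ac.
by move=> i j; exact: measurable_funTS.
Qed.

Lemma bounded_signal_ge0 n c (A : R -> 'M[R]_n) : bounded_signal c A -> 0 <= c.
Proof. by move=> [_ /(_ 0)]; exact: le_trans. Qed.

(** Composition with the nonexpansive projection [cl] of the line onto [[0, T]] extends [X]
    continuously. Measurability and continuity within the segment both follow from such an
    extension. *)
Lemma lipschitz_within n p (T K : R) (X : R -> 'M[R]_(n, p)) :
  0 <= T ->
  (forall r s, 0 <= r -> r <= s -> s <= T -> `|X s - X r| <= K * (s - r)) ->
  exists2 Y : R -> 'M[R]_(n, p), continuous Y & forall t, 0 <= t <= T -> X t = Y t.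
Proof.
move=> T0 XK; pose cl (t : R) := Num.max 0 (Num.min t T).
have cl_id t : 0 <= t <= T -> cl t = t.
  by move=> /andP[t0 tT]; rewrite /cl min_l// max_r.
have cl0 t : 0 <= cl t by rewrite /cl le_max lexx.
have clT t : cl t <= T by rewrite /cl ge_max T0 ge_min lexx orbT.
have cl_le s t : s <= t -> cl s <= cl t /\ cl t - cl s <= t - s.
  rewrite /cl /Num.max /Num.min => st.
  by repeat case: ifPn; rewrite -?leNgt => *; split; lra.
exists (X \o cl) => [|t /cl_id /= ->//].
have XK' r s : `|X (cl s) - X (cl r)| <= `|K| * `|s - r|.
  wlog rs : r s / r <= s.
    move=> H; have [/H//|/ltW/H] := leP r s.
    by rewrite distrC [X in _ <= _ * X]distrC.
  have [cc cd] := cl_le _ _ rs.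
  rewrite (le_trans (XK _ _ (cl0 _) cc (clT _)))// (ger0_norm (_ : 0 <= s - r)) ?subr_ge0//.
  by apply: le_trans (ler_wpM2r _ (ler_norm K)) (ler_wpM2l _ cd); rewrite ?subr_ge0.
move=> t; apply/cvgrPdist_le => e e0.
have K0 : 0 < `|K| + 1 by rewrite ltr_wpDl.
near=> s; rewrite /= (le_trans (XK' _ _))//.
apply: (@le_trans _ _ ((`|K| + 1) * `|t - s|)).
  by rewrite ler_wpM2r// lerDl.
rewrite -ler_pdivlMl//; near: s.
have /cvgrPdist_le := @cvg_id _ (nbhs t); apply.
by rewrite mulr_gt0// invr_gt0.
Unshelve. all: by end_near. Qed.

Lemma lipschitz_bounded_measurable n p (T K : R) (X : R -> 'M[R]_(n, p)) :
  0 <= T ->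
  (forall r s, 0 <= r -> r <= s -> s <= T -> `|X s - X r| <= K * (s - r)) ->
  bounded_measurable `[0, T] X.
Proof.
move=> T0 XK; have [Y cY XY] := lipschitz_within T0 XK; split=> [i j|].
  apply: (@eq_measurable_fun _ _ _ _ _ (fun t => Y t i j)).
    by move=> t /set_mem/=; rewrite in_itv/= => /XY ->.
  apply: measurable_funTS; apply: continuous_measurable_fun => t.
  by apply: cvg_mx_entry; exact: cY.
exists (`|X 0| + `|K| * T) => t; rewrite /= in_itv/= => /andP[t0 tT].
rewrite -[X t](subrK (X 0)) (le_trans (ler_normD _ _))// addrC lerD2l.
rewrite (le_trans (XK _ _ (lexx 0) t0 tT))// subr0.
by apply: le_trans (ler_wpM2r _ (ler_norm K)) (ler_wpM2l _ tT).
Qed.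

(** Compared with [fundamental_solution], continuity is weakened to bounded measurability, the
    initial value is arbitrary, and [p] columns are allowed, so that matrix flows and vector
    trajectories are treated alike. *)
Definition solution n p (A : R -> 'M[R]_n) (T : R) (P : 'M[R]_(n, p))
    (X : R -> 'M[R]_(n, p)) :=
  bounded_measurable `[0, T] X /\
  forall r, 0 <= r <= T -> X r = P + mxint `[0, r] (fun u => A u *m X u).

Section Bounds.
Variables (n : nat) (A : R -> 'M[R]_n) (c : R).
Hypothesis bA : bounded_signal c A.

Let c0 : 0 <= c. Proof. exact: bounded_signal_ge0 bA. Qed.

(* Twice the Lipschitz constant of [x |-> A t *m x] for the max norm, made
   positive. *)
Definition growth_rate (k : nat) (d : R) : R := 2 * (k%:R * d) + 1.

Local Notation l := (growth_rate n c).

Lemma growth_rate_gt0 : 0 < l.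
Proof. by rewrite ltr_wpDl// !mulr_ge0. Qed.

Let nc0 : 0 <= n%:R * c. Proof. exact: mulr_ge0. Qed.

Lemma bounded_measurable_field p (D : set R) (X : R -> 'M[R]_(n, p)) :
  measurable D -> bounded_measurable D X ->
  bounded_measurable D (fun u => A u *m X u).
Proof.
move=> mD bX; apply: bounded_measurableM => //.
exact: bounded_signal_measurable bA.
Qed.

Lemma field_norm_le p (x : 'M[R]_(n, p)) t : `|A t *m x| <= n%:R * c * `|x|.
Proof.
rewrite (le_trans (mx_norm_mul _ _))// ler_wpM2r// ler_wpM2l//.
exact: bA.2.
Qed.

Lemma mxint_field_le p (a b M : R) (X : R -> 'M[R]_(n, p)) :
  a <= b -> 0 <= M -> bounded_measurable `[a, b] X ->
  (forall u, a <= u <= b -> `|X u| <= M) ->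
  `|mxint `[a, b] (fun u => A u *m X u)| <= n%:R * c * M * (b - a).
Proof.
move=> ab M0 bX XM; apply: mxint_norm_le_cst => //.
  exact: bounded_measurable_field.
by move=> t tab; rewrite (le_trans (field_norm_le _ _))// ler_wpM2l// XM.
Qed.

Let mxint_field_exp p (a b M k : R) (X : R -> 'M[R]_(n, p)) :
  k != 0 -> a <= b -> 0 <= M -> bounded_measurable `[a, b] X ->
  (forall u, a <= u <= b -> `|X u| <= M * expR (k * u)) ->
  `|mxint `[a, b] (fun u => A u *m X u)| <=
  n%:R * c * M * ((expR (k * b) - expR (k * a)) / k).
Proof.
move=> k0 ab M0 bX XM; rewrite -Rintegral_expR_scale// -RintegralZl//; last first.
  exact: expR_scale_integrable.
apply: mxint_norm_le; first exact: bounded_measurable_field.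
  by apply: RintegrableZ => //; exact: expR_scale_integrable.
move=> t tab; rewrite (le_trans (field_norm_le _ _))// -[leRHS]mulrA.
by rewrite ler_wpM2l// XM.
Qed.

(** This is what the choice of [growth_rate] is for: the integral operator becomes a contraction of
    factor 1/2 for the sup norm weighted by an exponential (Bielecki's norm). *)
Let half : n%:R * c / l <= 1 / 2.
Proof.
rewrite ler_pdivrMr ?growth_rate_gt0// /growth_rate; lra.
Qed.

Lemma mxint_field_exp_forward p (a b M : R) (X : R -> 'M[R]_(n, p)) :
  a <= b -> 0 <= M -> bounded_measurable `[a, b] X ->
  (forall u, a <= u <= b -> `|X u| <= M * expR (l * u)) ->
  `|mxint `[a, b] (fun u => A u *m X u)| <= M / 2 * expR (l * b).
Proof.
move=> ab M0 bX XM.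
apply: le_trans (mxint_field_exp _ ab M0 bX XM) _.
  by rewrite gt_eqF// growth_rate_gt0.
apply: (@le_trans _ _ (n%:R * c / l * (M * expR (l * b)))).
  rewrite (_ : n%:R * c * M * _ =
    n%:R * c / l * (M * (expR (l * b) - expR (l * a)))); last by ring.
  rewrite ler_wpM2l ?divr_ge0 ?(ltW growth_rate_gt0)//.
  by rewrite ler_wpM2l// gerBl expR_ge0.
rewrite (_ : M / 2 * _ = 1 / 2 * (M * expR (l * b))); last by ring.
by rewrite ler_wpM2r// mulr_ge0 ?expR_ge0.
Qed.

(** The decreasing weight bounds the integral by its value at the left end [a], as is required to
    follow a solution backwards from its final time. *)
Lemma mxint_field_exp_backward p (a b M : R) (X : R -> 'M[R]_(n, p)) :
  a <= b -> 0 <= M -> bounded_measurable `[a, b] X ->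
  (forall u, a <= u <= b -> `|X u| <= M * expR (- l * u)) ->
  `|mxint `[a, b] (fun u => A u *m X u)| <= M / 2 * expR (- l * a).
Proof.
move=> ab M0 bX XM.
apply: le_trans (mxint_field_exp _ ab M0 bX XM) _.
  by rewrite oppr_eq0 gt_eqF// growth_rate_gt0.
rewrite invrN mulrN -mulNr opprB.
apply: (@le_trans _ _ (n%:R * c / l * (M * expR (- l * a)))).
  rewrite (_ : n%:R * c * M * _ =
    n%:R * c / l * (M * (expR (- l * a) - expR (- l * b)))); last by ring.
  rewrite ler_wpM2l ?divr_ge0 ?(ltW growth_rate_gt0)//.
  by rewrite ler_wpM2l// gerBl expR_ge0.
rewrite (_ : M / 2 * _ = 1 / 2 * (M * expR (- l * a))); last by ring.
by rewrite ler_wpM2r// mulr_ge0 ?expR_ge0.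
Qed.

Let sub_itv (r s T : R) : 0 <= r -> s <= T -> `[r, s] `<=` `[0, T].
Proof. by move=> r0 sT; apply: subset_itv; rewrite bnd_simp. Qed.

Lemma solution_step p T P (X : R -> 'M[R]_(n, p)) r s :
  solution A T P X -> 0 <= r -> r <= s -> s <= T ->
  X s = X r + mxint `[r, s] (fun u => A u *m X u).
Proof.
move=> [bX Xe] r0 rs sT.
rewrite (Xe s); last by rewrite sT (le_trans r0).
rewrite (Xe r); last by rewrite r0 (le_trans rs).
rewrite -addrA -mxint_split//.
apply: bounded_measurable_field => //.
by apply: bounded_measurableS bX => //; exact: sub_itv.
Qed.

(** Grönwall's inequality: boundedness of [X] gives some initial constant, which the contraction
    absorbs. *)
Lemma solution_le p T P (X : R -> 'M[R]_(n, p)) r :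
  solution A T P X -> 0 <= r <= T -> `|X r| <= 2 * `|P| * expR (l * r).
Proof.
move=> [bX Xe]; have [B XB] := bX.2.
have exp1 u : 0 <= u -> 1 <= expR (l * u).
  by move=> u0; rewrite -expR0 ler_expR mulr_ge0// ltW// growth_rate_gt0.
have iff u : (`[0, T]%classic u) = (0 <= u <= T) by rewrite /= in_itv.
move=> rT; apply: (@weighted_absorption `[0, T] (fun u => `|X u|)
  (fun u => expR (l * u)) `|P| `|B|) => //.
- move=> u uT; rewrite (le_trans (XB _ uT))// (le_trans (ler_norm _))//.
  by rewrite ler_peMr// exp1//; move: uT; rewrite iff => /andP[].
- move=> M M0 XM u; rewrite iff => uT; rewrite Xe//.
  rewrite (le_trans (ler_normD _ _))// mulrDl; move/andP: uT => [u0 uT].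
  apply: lerD; first by rewrite ler_peMr// exp1.
  apply: mxint_field_exp_forward => //.
    by apply: bounded_measurableS bX => //; exact: sub_itv.
  move=> v /andP[v0 vu]; apply: XM; rewrite iff v0 (le_trans vu)//.
Qed.

(** Grönwall's inequality backwards, with [X T] as the datum. The factor [expR (l * T)] makes the
    weight at least 1 on [[0, T]]. Applied to trajectories, it yields invertibility of flows
    together with a lower bound. *)
Lemma solution_ge p T P (X : R -> 'M[R]_(n, p)) :
  0 <= T -> solution A T P X -> `|P| <= 2 * expR (l * T) * `|X T|.
Proof.
move=> T0 solX; have [bX Xe] := solX; have [B XB] := bX.2.
have iff u : (`[0, T]%classic u) = (0 <= u <= T) by rewrite /= in_itv.
have expT u : u <= T -> 1 <= expR (l * T) * expR (- l * u).
  move=> uT; rewrite -expRD mulNr -mulrBr -expR0 ler_expR mulr_ge0// ?subr_ge0//.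
  by rewrite ltW// growth_rate_gt0.
have H : forall u, `[0, T]%classic u ->
    `|X u| <= 2 * (`|X T| * expR (l * T)) * expR (- l * u).
  apply: (@weighted_absorption `[0, T] (fun u => `|X u|)
    (fun u => expR (- l * u)) _ (`|B| * expR (l * T))) => //.
  - move=> u uT; rewrite (le_trans (XB _ uT))// (le_trans (ler_norm _))//.
    by rewrite -mulrA ler_peMr// expT//; move: uT; rewrite iff => /andP[].
  - move=> M M0 XM u; rewrite iff => /andP[u0 uT].
    have -> : X u = X T - mxint `[u, T] (fun v => A v *m X v).
      by rewrite (solution_step solX u0 uT (lexx T)) addrK.
    rewrite (le_trans (ler_normB _ _))// mulrDl; apply: lerD.
      by rewrite -mulrA ler_peMr// expT.
    apply: mxint_field_exp_backward => //.
      by apply: bounded_measurableS bX => //; exact: sub_itv.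
    by move=> v /andP[uv vT]; apply: XM; rewrite iff (le_trans u0 uv).
have X0 : X 0 = P.
  rewrite Xe ?lexx// set_itv1 (_ : mxint _ _ = 0) ?addr0//.
  by apply/matrixP => i j; rewrite !mxE Rintegral_set1.
have := H 0; rewrite iff lexx T0 => /(_ isT).
by rewrite X0 mulr0 expR0 mulr1 -mulrA [`|X T| * _]mulrC mulrA.
Qed.

(** The Lipschitz constant depends on the signal through [c] only, hence is common to a bounded
    family of signals. *)
Lemma solution_lipschitz p T P (X : R -> 'M[R]_(n, p)) r s :
  solution A T P X -> 0 <= r -> r <= s -> s <= T ->
  `|X s - X r| <= n%:R * c * (2 * `|P| * expR (l * T)) * (s - r).
Proof.
move=> solX r0 rs sT.
rewrite (solution_step solX r0 rs sT) addrC addKr.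
apply: mxint_field_le => //.
  by apply: bounded_measurableS solX.1 => //; exact: sub_itv.
move=> u /andP[ru us].
have uT : u <= T by exact: le_trans sT.
rewrite (le_trans (solution_le solX _)) ?(le_trans r0)//.
by rewrite ler_wpM2l ?mulr_ge0// ler_expR ler_wpM2l// ltW// growth_rate_gt0.
Qed.

Lemma solutionB p T P Q (X Y : R -> 'M[R]_(n, p)) :
  solution A T P X -> solution A T Q Y ->
  solution A T (P - Q) (fun t => X t - Y t).
Proof.
move=> [bX Xe] [bY Ye]; split; first exact: bounded_measurableB.
move=> r rT; have [r0 r1] := andP rT.
rewrite Xe// Ye// opprD addrACA -mxintB.
- by congr (_ + _); apply: eq_mxint => u _; rewrite mulmxBr.
- by apply: bounded_measurable_field => //; apply: bounded_measurableS bX => //; exact: sub_itv.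
- by apply: bounded_measurable_field => //; apply: bounded_measurableS bY => //; exact: sub_itv.
Qed.

Lemma solution_unique p T P (X Y : R -> 'M[R]_(n, p)) r :
  solution A T P X -> solution A T P Y -> 0 <= r <= T -> X r = Y r.
Proof.
move=> sX sY rT; apply/eqP; rewrite -subr_eq0 -normr_le0.
have := solution_le (solutionB sX sY) rT.
by rewrite subrr normr0 mulr0 mul0r.
Qed.

Lemma solution_mulr p q T P (X : R -> 'M[R]_(n, p)) (Q : 'M[R]_(p, q)) :
  solution A T P X -> solution A T (P *m Q) (fun t => X t *m Q).
Proof.
move=> [bX Xe]; split.
  by apply: bounded_measurableM => //; exact: bounded_measurable_cst.
move=> r rT; rewrite Xe// mulmxDl -mxint_mulr.
  by congr (_ + _); apply: eq_mxint => u _; rewrite mulmxA.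
have [r0 r1] := andP rT.
by apply: bounded_measurable_field => //; apply: bounded_measurableS bX => //; exact: sub_itv.
Qed.

Lemma solutionS p T T' P (X : R -> 'M[R]_(n, p)) :
  T' <= T -> solution A T P X -> solution A T' P X.
Proof.
move=> TT' [bX Xe]; split.
  by apply: bounded_measurableS bX => //; exact: sub_itv.
by move=> r /andP[r0 rT]; rewrite Xe// r0 (le_trans rT).
Qed.

End Bounds.

End Solutions.

(** * Passing to the limit in the integral equation *)

Section Limits.
Variables (R : realType) (U : set_system nat).
Context {UU : ProperFilter U}.
Local Notation mu := (@lebesgue_measure R).

Definition lipschitz_on n p (T K : R) (X : R -> 'M[R]_(n, p)) :=
  forall r s, 0 <= r -> r <= s -> s <= T -> `|X s - X r| <= K * (s - r).

Lemma equilipschitz_cvg n p (T K : R) (x : nat -> R -> 'M[R]_(n, p))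
    (X : R -> 'M[R]_(n, p)) :
  (forall k, lipschitz_on T K (x k)) ->
  (forall r, 0 <= r <= T -> x k r @[k --> U] --> X r) -> lipschitz_on T K X.
Proof.
move=> xK xX r s r0 rs sT.
apply: (@cvgr_to_le _ U _ _ (fun k => `|x k s - x k r|)).
  apply: cvg_norm; apply: cvgB; apply: xX.
    by rewrite (le_trans r0).
  by rewrite r0 (le_trans rs).
by apply: nearW => k; exact: xK.
Qed.

(** The half of Ascoli's argument that upgrades pointwise to uniform convergence: closeness on a
    finite grid of step [h] propagates to all points by the common Lipschitz constant. *)
Lemma equilipschitz_uniform n p (T K : R) (x : nat -> R -> 'M[R]_(n, p))
    (X : R -> 'M[R]_(n, p)) (e : R) :
  0 < e -> (forall k, lipschitz_on T K (x k)) ->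
  (forall r, 0 <= r <= T -> x k r @[k --> U] --> X r) ->
  \forall k \near U, forall r, 0 <= r <= T -> `|x k r - X r| <= e.
Proof.
move=> e0 xK xX; have XK := equilipschitz_cvg xK xX.
(* Over one grid step a function moves by at most [e / 3]; adding 1 to the absolute value of [K]
   avoids a division by 0. *)
pose h := e / 3 / (`|K| + 1).
have K1 : 0 < `|K| + 1 by rewrite ltr_wpDl.
have h0 : 0 < h by rewrite !divr_gt0.
have Kh : `|K| * h <= e / 3.
  rewrite /h mulrCA ger_pMr ?divr_gt0// ler_pdivrMr// mul1r lerDl//.
pose m := Num.bound (T / h).
have : \forall k \near U, forall i : 'I_m.+1,
    0 <= i%:R * h <= T -> `|x k (i%:R * h) - X (i%:R * h)| <= e / 3.
  apply: filter_forall => i.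
  have [iT|niT] := pselect (0 <= i%:R * h <= T); last by apply: nearW.
  have : \forall k \near U, `|X (i%:R * h) - x k (i%:R * h)| <= e / 3.
    by move/cvgrPdist_le : (xX _ iT); apply; rewrite divr_gt0.
  by apply: filterS => k; rewrite distrC.
apply: filterS => k xk r /andP[r0 rT].
pose i := Num.truncn (r / h).
have rh0 : 0 <= r / h by rewrite divr_ge0// ltW.
have /andP[ir ri] := Num.Theory.truncn_itv rh0.
have ih : i%:R * h <= r by rewrite -ler_pdivlMr.
have hi : r - i%:R * h <= h.
  rewrite lerBlDl (_ : _ + h = i.+1%:R * h) -?ler_pdivrMr//; first exact: ltW.
  by rewrite -addn1 natrD mulrDl mul1r.
have im : (i < m.+1)%N.
  rewrite ltnS -(ler_nat R) (le_trans ir)//.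
  apply: (@le_trans _ _ (T / h)); first by rewrite ler_wpM2r// invr_ge0 ltW.
  by apply/ltW/archi_boundP; rewrite (le_trans rh0)// ler_wpM2r// invr_ge0 ltW.
have ih0 : 0 <= i%:R * h by rewrite mulr_ge0// ltW.
have := xk (Ordinal im); rewrite /= ih0 (le_trans ih rT) => /(_ isT) xki.
have lipe (Y : R -> 'M[R]_(n, p)) : lipschitz_on T K Y ->
    `|Y r - Y (i%:R * h)| <= e / 3.
  move=> YK; rewrite (le_trans (YK _ _ ih0 ih rT))// (le_trans _ Kh)//.
  by apply: le_trans (ler_wpM2r _ (ler_norm K)) (ler_wpM2l _ hi); rewrite ?subr_ge0.
have := lipe _ (xK k); have := lipe _ XK.
have -> : x k r - X r = (x k r - x k (i%:R * h)) +
    (x k (i%:R * h) - X (i%:R * h)) - (X r - X (i%:R * h)).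
  by rewrite subrKA opprB subrKA.
move=> h1 h2; rewrite (le_trans (ler_normB _ _))//.
have := ler_normD (x k r - x k (i%:R * h)) (x k (i%:R * h) - X (i%:R * h)).
move: h1 h2 xki; lra.
Qed.

(** Weak times strong: the integrand [A k *m x k - B *m X] is split as [A k *m (x k - X)], small by
    uniform convergence, plus [(A k - B) *m X], where the fixed entries of [X] cut off to [[0, r]]
    act as test functions. *)
Lemma mxint_field_cvg n p (c T K : R) (A : nat -> R -> 'M[R]_n)
    (B : R -> 'M[R]_n) (x : nat -> R -> 'M[R]_(n, p)) (X : R -> 'M[R]_(n, p)) r :
  (forall k, bounded_signal c (A k)) -> bounded_signal c B ->
  (forall i j g, mu.-integrable setT (EFin \o g) ->
    \int[mu]_t (g t * A k t i j) @[k --> U] --> \int[mu]_t (g t * B t i j)) ->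
  (forall k, lipschitz_on T K (x k)) ->
  (forall r, 0 <= r <= T -> x k r @[k --> U] --> X r) ->
  0 <= r <= T ->
  mxint `[0, r] (fun u => A k u *m x k u) @[k --> U] -->
  mxint `[0, r] (fun u => B u *m X u).
Proof.
move=> bA bB AB xK xX /andP[r0 rT].
have sub : `[0, r]%classic `<=` `[0, T] by apply: subset_itv; rewrite bnd_simp.
have T0 : 0 <= T by exact: le_trans rT.
have bx k : bounded_measurable `[0, r] (x k).
  apply: bounded_measurableS sub _ => //.
  exact: lipschitz_bounded_measurable (xK k).
have bX : bounded_measurable `[0, r] X.
  apply: bounded_measurableS sub _ => //.
  exact: lipschitz_bounded_measurable (equilipschitz_cvg xK xX).
have c0 := bounded_signal_ge0 bB.
have AX : mxint `[0, r] (fun u => A k u *m X u) @[k --> U] -->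
    mxint `[0, r] (fun u => B u *m X u).
  apply: mx_cvg => i j.
  have E (C : R -> 'M[R]_n) : bounded_signal c C ->
      mxint `[0, r] (fun u => C u *m X u) i j =
      \sum_(l < n) \int[mu]_t (((fun t => X t l j) \_ `[0, r]%classic) t * C t i l).
    move=> bC; rewrite mxE; under eq_Rintegral do rewrite mxE.
    rewrite Rintegral_sum//.
      apply: eq_bigr => l _; rewrite [LHS]Rintegral_mkcond.
      apply: eq_Rintegral => t _; rewrite !patchE.
      by case: ifP => _; rewrite ?mul0r// mulrC.
    move=> l; rewrite (_ : (fun t => _) = (fun t => X t l j * C t i l)); last first.
      by apply/funext => t; rewrite mulrC.
    apply: (@Rintegrable_mulb R _ _ (fun t => X t l j) (fun t => C t i l) c) => //.
    - exact: bounded_measurable_integrable.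
    - by apply: measurable_funTS; exact: bC.1.
    - by move=> t _; rewrite (le_trans (mx_norm_entry _ _ _))// bC.2.
  rewrite E//; under eq_fun do rewrite E//.
  apply: cvg_big => [|l _]; first exact: add_continuous.
  apply: AB.
  have := bounded_measurable_integrable l j bX.
  by rewrite integrable_mkcond//= restrict_EFin.
apply/cvgrPdist_le => e e0.
have k0 : 0 < n%:R * c * r + 1 by rewrite ltr_wpDl// !mulr_ge0.
have e'0 : 0 < e / 2 / (n%:R * c * r + 1) by rewrite !divr_gt0.
have near1 := equilipschitz_uniform e'0 xK xX.
have near2 : \forall k \near U, `|mxint `[0, r] (fun u => B u *m X u) -
    mxint `[0, r] (fun u => A k u *m X u)| <= e / 2.
  by move/cvgrPdist_le : AX; apply; rewrite divr_gt0.
apply: filterS2 near1 near2 => k h1 h2.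
have h3 : `|mxint `[0, r] (fun u => A k u *m X u) -
    mxint `[0, r] (fun u => A k u *m x k u)| <= e / 2.
  rewrite -mxintB; [|exact: bounded_measurable_field|exact: bounded_measurable_field].
  rewrite (@eq_mxint _ _ _ _ _ (fun u => A k u *m (X u - x k u))); last first.
    by move=> t _; rewrite mulmxBr.
  apply: le_trans (mxint_field_le (bA k) r0 (ltW e'0) _ _) _.
  - exact: bounded_measurableB.
  - move=> u /andP[u0 ur]; rewrite distrC h1// u0 (le_trans ur)//.
  - rewrite subr0 mulrAC mulrCA ger_pMr ?divr_gt0//.
    by rewrite ler_pdivrMr// mul1r lerDl.
rewrite -[X in `|X|](subrKA (mxint `[0, r] (fun u => A k u *m X u))).
apply: le_trans (ler_normD _ _) _.
by apply: le_trans (lerD h2 h3) _; rewrite -splitr.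
Qed.

End Limits.

(** * Existence of solutions by Picard iteration *)

Section Existence.
Variables (R : realType) (n p : nat) (A : R -> 'M[R]_n) (c : R).
Hypothesis bA : bounded_signal c A.
Variables (T : R) (P : 'M[R]_(n, p)).
Hypothesis T0 : 0 <= T.
Local Notation l := (growth_rate n c).

Fixpoint picard (m : nat) : R -> 'M[R]_(n, p) :=
  if m is k.+1 then fun r => P + mxint `[0, r] (fun u => A u *m picard k u)
  else fun=> P.

Let picardS m r : picard m.+1 r = P + mxint `[0, r] (fun u => A u *m picard m u).
Proof. by []. Qed.

Let sub_itv (r s : R) : 0 <= r -> s <= T -> `[r, s] `<=` `[0, T].
Proof. by move=> r0 sT; apply: subset_itv; rewrite bnd_simp. Qed.

Let K := n%:R * c * (2 * `|P| * expR (l * T)).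

Let l0 : 0 <= l. Proof. exact: ltW (growth_rate_gt0 bA). Qed.

Let exp1 u : 0 <= u -> 1 <= expR (l * u).
Proof. by move=> u0; rewrite -expR0 ler_expR mulr_ge0. Qed.

Let picard_spec m : lipschitz_on T K (picard m) /\
  forall u, 0 <= u <= T -> `|picard m u| <= 2 * `|P| * expR (l * u).
Proof.
have c0 := bounded_signal_ge0 bA.
elim: m => [|m [ihK ih]].
  split=> [r s _ rs _|u /andP[u0 _]] /=.
    by rewrite subrr normr0 mulr_ge0 ?subr_ge0// !mulr_ge0 ?expR_ge0.
  by rewrite mulrAC ler_peMl// (le_trans (exp1 u0))// ler_peMl ?expR_ge0// ler1n.
have bm := lipschitz_bounded_measurable T0 ihK.
split=> [r s r0 rs sT|u /andP[u0 uT]] /=.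
  rewrite (@mxint_split _ _ _ 0 r s)//; last first.
    apply: (bounded_measurable_field bA) => //.
    by apply: bounded_measurableS bm => //; exact: sub_itv.
  rewrite opprD addrACA subrr add0r addrAC subrr add0r; apply: (mxint_field_le bA) => //.
    by apply: bounded_measurableS bm => //; exact: sub_itv.
  move=> u /andP[ru us]; rewrite (le_trans (ih _ _))//.
    by rewrite (le_trans r0 ru) (le_trans us).
  by rewrite ler_wpM2l ?mulr_ge0// ler_expR ler_wpM2l// (le_trans us).
rewrite (le_trans (ler_normD _ _))//.
(* Twice the norm of [P] is the fixed point of the affine map that adds that norm to half of the
   constant, so the bound reproduces itself. *)
rewrite (_ : 2 * `|P| * _ = `|P| * expR (l * u) + 2 * `|P| / 2 * expR (l * u)); last by field.
apply: lerD; first by rewrite ler_peMr// exp1.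
apply: (mxint_field_exp_forward bA) => //.
  by apply: bounded_measurableS bm => //; exact: sub_itv.
by move=> v /andP[v0 vu]; apply: ih; rewrite v0 (le_trans vu).
Qed.

Let picard_bm m r : r <= T -> bounded_measurable `[0, r] (picard m).
Proof.
move=> rT; apply: (@bounded_measurableS _ _ _ `[0, T]) => //.
  exact: sub_itv.
exact: lipschitz_bounded_measurable T0 (picard_spec m).1.
Qed.

Let picard_diff m u : 0 <= u <= T ->
  `|picard m.+1 u - picard m u| <= 4 * `|P| / 2 ^+ m * expR (l * u).
Proof.
elim: m u => [|m ih] u uT.
  rewrite expr0 divr1 (le_trans (ler_normB _ _))//.
  have h1 := (picard_spec 1).2 u uT; have h0 := (picard_spec 0).2 u uT.
  by rewrite (le_trans (lerD h1 h0))// -mulrDl -mulrDl -natrD.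
have [u0 u1] := andP uT.
rewrite (picardS m.+1) (picardS m) opprD addrACA subrr add0r.
rewrite -mxintB; [|by apply: (bounded_measurable_field bA) => //; exact: (picard_bm _ u1)..].
rewrite (@eq_mxint _ _ _ _ _ (fun v => A v *m (picard m.+1 v - picard m v))); last first.
  by move=> v _; rewrite mulmxBr.
rewrite (_ : 4 * `|P| / 2 ^+ m.+1 = 4 * `|P| / 2 ^+ m / 2); last first.
  by rewrite exprSr invfM mulrA.
apply: (mxint_field_exp_forward bA) => //.
- by apply: bounded_measurableB; exact: picard_bm.
- by move=> v /andP[v0 vu]; apply: ih; rewrite v0 (le_trans vu).
Qed.

(** The iterates have a pointwise limit along an ultrafilter, and [mxint_field_cvg] with the
    constant sequence [A] passes to the limit in the recursion. *)
Lemma solution_exists : exists X, solution A T P X.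
Proof.
have [U [UU Uoo]] := free_ultrafilter.
have cvx r : 0 <= r <= T -> exists L : 'M[R]_(n, p), picard m r @[m --> U] --> L.
  move=> rT; apply: (@ultra_cvg_mx R U UU _ _ _ (2 * `|P| * expR (l * r))) => m.
  exact: (picard_spec m).2.
pose X r : 'M[R]_(n, p) := lim (picard m r @[m --> U]).
have xX r : 0 <= r <= T -> picard m r @[m --> U] --> X r.
  by move=> /cvx[L xL]; apply: (cvgP L).
exists X; split.
  apply: lipschitz_bounded_measurable T0 _.
  by apply: equilipschitz_cvg xX => m; exact: (picard_spec m).1.
move=> r rT.
have h1 : picard m.+1 r @[m --> U] --> P + mxint `[0, r] (fun u => A u *m X u).
  apply: cvgD; first exact: cvg_cst.
  apply: (@mxint_field_cvg R U _ n p c T K (fun=> A) A) => //.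
  - by move=> i j g gi; exact: cvg_cst.
  - by move=> m; exact: (picard_spec m).1.
(* Convergence along an ultrafilter is not invariant under a shift of the index; consecutive
   iterates have the same limit because their differences decay geometrically. *)
have h2 : picard m.+1 r @[m --> U] --> X r.
  apply: cvg_sub0 (xX _ rT); apply/norm_cvg0P.
  have h3 : 4 * `|P| / 2 ^+ m * expR (l * r) @[m --> U] --> (0 : R).
    apply: (cvg_trans (cvg_app _ Uoo)).
    rewrite -[X in _ --> X](mul0r (expR (l * r))); apply: cvgM; last exact: cvg_cst.
    rewrite -[X in _ --> X](mulr0 (4 * `|P|)); apply: cvgM; first exact: cvg_cst.
    under eq_fun do rewrite -exprVn.
    by apply: cvg_expr; rewrite ger0_norm ?invr_ge0// invf_lt1 ?ltr1n.
  apply: (squeeze_cvgr _ (cvg_cst 0) h3).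
  by apply: nearW => m; rewrite normr_ge0 /= picard_diff.
exact: (cvg_unique (@norm_hausdorff _ _) h2 h1).
Qed.

End Existence.

(** * Translation invariance of the Lebesgue integral *)

Section Translation.
Variable R : realType.
Local Notation mu := (@lebesgue_measure R).

Lemma measurable_translation (t : R) : measurable_fun setT (+%R t : R -> R).
Proof.
by apply: continuous_measurable_fun => u; apply: cvgD; [exact: cvg_cst|exact: cvg_id].
Qed.

Lemma translation_preimage_itv (t a b : R) (x y : bool) :
  (+%R t) @^-1` [set` Interval (BSide x a) (BSide y b)] =
  [set` Interval (BSide x (a - t)) (BSide y (b - t))].
Proof.
apply/seteqP; split=> u /=; rewrite !in_itv /=; case: x; case: y => /=;
  move=> /andP[h1 h2]; apply/andP; split; lra.
Qed.

(** Lebesgue measure is determined by the lengths of half-open intervals, which translations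
    preserve. *)
Lemma lebesgue_measure_translation (t : R) (D : set R) : measurable D ->
  pushforward mu (+%R t : measurableTypeR R -> measurableTypeR R) D = mu D.
Proof.
move=> mD; apply/esym.
pose f : measurableTypeR R -> measurableTypeR R := +%R t.
have mf : measurable_fun setT f by exact: measurable_translation.
pose f' : {mfun measurableTypeR R >-> measurableTypeR R} :=
  MeasurableFun.Pack (MeasurableFun.Class (isMeasurableFun.Build _ _ _ _ _ mf)).
have := @lebesgue_measure_unique R (pushforward mu f').
apply => //= _ [[a b]] _ <-.
rewrite /pushforward /f' /= (_ : f @^-1` _ = `](a - t), (b - t)]%classic); last first.
  exact: (translation_preimage_itv t a b false false).
rewrite !lebesgue_measure_itv/= !lte_fin ltrD2r.
by case: ifP => // _; rewrite -!EFinB; congr EFin; ring.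
Qed.

Lemma Rintegral_translation (t a b : R) (g : R -> R) : measurable_fun setT g ->
  mu.-integrable `[t + a, t + b] (EFin \o g) ->
  \int[mu]_(u in `[a, b]) g (t + u) = \int[mu]_(u in `[t + a, t + b]) g u.
Proof.
move=> mg gi.
pose f : measurableTypeR R -> measurableTypeR R := +%R t.
have mf : measurable_fun setT f by exact: measurable_translation.
have fE : f @^-1` `[t + a, t + b]%classic = `[a, b]%classic.
  rewrite (translation_preimage_itv t (t + a) (t + b) true false).
  by rewrite ![t + _]addrC !addrK.
have mg' : measurable_fun setT (EFin \o g) by exact/measurable_EFinP.
have gfi : mu.-integrable (f @^-1` `[t + a, t + b]%classic) ((EFin \o g) \o f).
  apply/integrableP; split.
    by apply: measurable_funTS; apply: measurableT_comp.
  move/integrableP : gi => [_]; apply: le_lt_trans.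
  have mabs : measurable_fun setT (fun x => `|(EFin \o g) x|%E).
    exact: measurableT_comp.
  have := @ge0_integral_pushforward _ _ _ _ R f mf mu `[t + a, t + b]%classic
    (fun x => `|(EFin \o g) x|%E) (measurable_itv _) (measurable_funTS mabs)
    (fun x _ => abse_ge0 _).
  move=> /= <-; rewrite le_eqVlt; apply/orP; left; apply/eqP.
  by apply: eq_measure_integral => //= D mD _; exact: lebesgue_measure_translation.
rewrite /Rintegral; congr fine.
have := @integral_pushforward _ _ _ _ R f mf mu `[t + a, t + b]%classic
  (EFin \o g) mg' gfi (measurable_itv _).
rewrite fE => /= <-.
by apply: eq_measure_integral => //= D mD _; exact: lebesgue_measure_translation.
Qed.

End Translation.

(** * Flows *)

Section Flow.
Variables (R : realType) (n : nat).
Local Notation mu := (@lebesgue_measure R).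
Implicit Types A B : R -> 'M[R]_n.

Lemma eq_solution p A T (P : 'M[R]_(n, p)) X Y :
  (forall r, 0 <= r <= T -> X r = Y r) -> solution A T P X -> solution A T P Y.
Proof.
move=> XY [[mX [k Xk]] Xe].
have iff u : (`[0, T]%classic u) = (0 <= u <= T) by rewrite /= in_itv.
split; first split.
- move=> i j; apply: (@eq_measurable_fun _ _ _ _ _ (fun t => X t i j)) => //.
  by move=> t /set_mem; rewrite iff => /XY ->.
- by exists k => t /[dup]; rewrite {1}iff => /XY <-; exact: Xk.
- move=> r /andP[r0 rT]; rewrite -XY ?r0// Xe ?r0//; congr (_ + _).
  apply: eq_mxint => u; rewrite /= in_itv/= => /andP[u0 ur].
  by rewrite XY// u0 (le_trans ur).
Qed.

(** A continuous function on a segment is bounded and measurable; conversely a bounded measurable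
    solution is Lipschitz, hence continuous. *)
Lemma fundamental_solutionP A c T X : 0 <= T -> bounded_signal c A ->
  fundamental_solution A 0 T X <-> solution A T 1%:M X.
Proof.
move=> T0 bA; split=> [[cX Xe]|solX]; split.
- split=> [i j|].
    apply: subspace_continuous_measurable_fun => // t.
    by apply: cvg_mx_entry; exact: cX.
  have : compact (X @` `[0, T]).
    by apply: continuous_compact => //; exact: segment_compact.
  move=> /compact_bounded[k [_ kX]]; exists (k + 1) => t Tt.
  by apply: (kX (k + 1)); [rewrite ltrDl|exists t].
- by move=> r rT; rewrite Xe.
- have [Y cY XY] := lipschitz_within T0
    (fun r s => @solution_lipschitz _ _ _ _ bA _ _ _ _ r s solX).
  apply: (@subspace_eq_continuous _ _ _ Y).
    by move=> t /set_mem; rewrite /= in_itv/= => /XY /esym.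
  exact: continuous_subspaceT.
- by move=> r rT; rewrite solX.2.
Qed.

Lemma flowE A c T X : 0 <= T -> bounded_signal c A -> solution A T 1%:M X ->
  flow A T 0 = X T.
Proof.
move=> T0 bA solX; rewrite /flow; case: xgetP => [P -> [Y fY <-]|/(_ (X T))[]].
  move/(fundamental_solutionP _ T0 bA) : fY => solY.
  by apply: (solution_unique bA solY solX); rewrite T0 lexx.
by exists X => //; exact/(fundamental_solutionP _ T0 bA).
Qed.

Lemma flow_solution A c T : 0 <= T -> bounded_signal c A ->
  solution A T 1%:M (fun r => flow A r 0).
Proof.
move=> T0 bA; have [X solX] := solution_exists bA (1%:M : 'M[R]_n) T0.
apply: (eq_solution _ solX) => r /andP[r0 rT].
by rewrite (flowE r0 bA (solutionS rT solX)).
Qed.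

Lemma flow_le A c T : 0 <= T -> bounded_signal c A ->
  `|flow A T 0| <= 2 * expR (growth_rate n c * T).
Proof.
move=> T0 bA.
have := solution_le bA (flow_solution T0 bA) (_ : 0 <= T <= T).
rewrite T0 lexx => /(_ isT) /le_trans; apply.
by rewrite ler_wpM2r ?expR_ge0// ler_piMr// mx_norm1.
Qed.

Lemma flow_ge A c T (x : 'cV[R]_n) : 0 <= T -> bounded_signal c A ->
  `|x| <= 2 * expR (growth_rate n c * T) * `|flow A T 0 *m x|.
Proof.
move=> T0 bA.
have := solution_ge bA T0 (solution_mulr bA x (flow_solution T0 bA)).
by rewrite mul1mx.
Qed.

Lemma flow_unitmx A c T : 0 <= T -> bounded_signal c A -> flow A T 0 \in unitmx.
Proof.
(* [det0P] yields a row vector in a left kernel; transposing turns it into a column vector that the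
   flow sends to 0, against [flow_ge]. *)
move=> T0 bA; rewrite -unitmx_tr unitmxE unitfE; apply/det0P => -[v v0 vA].
have := flow_ge v^T T0 bA; rewrite -[flow A T 0]trmxK -trmx_mul vA trmx0 normr0.
rewrite mulr0 normr_le0 => /eqP/(congr1 trmx); rewrite trmxK trmx0 => v00.
by rewrite v00 eqxx in v0.
Qed.

Lemma flow0 A c : bounded_signal c A -> flow A 0 0 = 1%:M.
Proof.
move=> bA; have [_ /(_ 0)] := flow_solution (lexx 0) bA.
rewrite lexx => /(_ isT) ->; rewrite set_itv1 (_ : mxint _ _ = 0) ?addr0//.
by apply/matrixP => i j; rewrite !mxE Rintegral_set1.
Qed.

(** Time 0 is excluded because shifted and concatenated signals take another value at a junction; a
    single point does not change the integrals. *)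
Lemma eq_flow A B c d T : 0 <= T -> bounded_signal c A -> bounded_signal d B ->
  (forall t, 0 < t <= T -> A t = B t) -> flow A T 0 = flow B T 0.
Proof.
move=> T0 bA bB AB; have [bX Xe] := flow_solution T0 bA.
apply/esym; apply: (flowE T0 bB (X := fun r => flow A r 0)); split=> // r rT.
rewrite Xe//; congr (_ + _); apply/matrixP => i j; rewrite !mxE.
have [r0 rT'] := andP rT.
have bXr : bounded_measurable `[0, r] (fun r => flow A r 0).
  by apply: bounded_measurableS bX => //; apply: subset_itv; rewrite bnd_simp.
have oc (C : R -> 'M[R]_n) k : bounded_signal k C ->
    \int[mu]_(t in `]0, r]) (C t *m flow A t 0) i j =
    \int[mu]_(t in `[0, r]) (C t *m flow A t 0) i j.
  move=> bC; apply: Rintegral_itv_obnd_cbnd.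
  have := bounded_measurable_integrable i j (bounded_measurable_field bC (measurable_itv _) bXr).
  apply: integrableS => //; apply: subset_itv; rewrite bnd_simp//.
rewrite -(oc _ _ bA) -(oc _ _ bB); apply: eq_Rintegral => t /set_mem.
by rewrite /= in_itv/= => /andP[t0 tr]; rewrite AB// t0 (le_trans tr).
Qed.

Lemma bounded_signal_shift A c t : 0 <= t -> bounded_signal c A ->
  bounded_signal c (Defs.shift t A).
Proof.
move=> t0 bA; have c0 := bounded_signal_ge0 bA; have [mA Ac] := bA; split=> [i j|s]; last first.
  by rewrite /Defs.shift; case: ifP => _; rewrite ?normr0.
rewrite (_ : (fun s => _) = (fun s => if (0 : R) <= s then A (t + s) i j else 0)); last first.
  by apply/funext => s; rewrite /Defs.shift; case: ifP => // _; rewrite mxE.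
apply: measurable_fun_ifT => //.
  by apply: measurable_fun_ler; [exact: measurable_cst|exact: measurable_id].
exact: (measurableT_comp (mA i j) (measurable_translation t)).
Qed.

Lemma mxint_translation m p (t a b : R) (X : R -> 'M[R]_(m, p)) :
  bounded_measurable `[t + a, t + b] X ->
  mxint `[a, b] (fun u => X (t + u)) = mxint `[t + a, t + b] X.
Proof.
move=> bX; apply/matrixP => i j; rewrite !mxE.
(* The change of variables asks for measurability on the whole line, hence the extension by 0. *)
pose g := (fun u => X u i j) \_ `[t + a, t + b]%classic.
have mg : measurable_fun setT g.
  apply/(measurable_restrict _ _ _) => //; rewrite setTI.
  exact: bX.1.
have gX u : `[t + a, t + b]%classic u -> g u = X u i j.
  by move=> ub; rewrite /g patchE mem_set.
have -> : \int[mu]_(u in `[t + a, t + b]) X u i j =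
    \int[mu]_(u in `[t + a, t + b]) g u.
  by apply: eq_Rintegral => u /set_mem/gX ->.
rewrite -Rintegral_translation//.
  apply: eq_Rintegral => u /set_mem; rewrite /= in_itv/= => ab; rewrite gX//.
  by rewrite /= in_itv/= !lerD2l.
have := bounded_measurable_integrable i j bX.
by apply: eq_integrable => //= u uab; rewrite gX//; exact: set_mem.
Qed.

(** Cocycle property, by uniqueness: both sides solve the shifted equation from [flow A t 0]. *)
Lemma flow_shift A c t s : 0 <= t -> 0 <= s -> bounded_signal c A ->
  flow A (t + s) 0 = flow (Defs.shift t A) s 0 *m flow A t 0.
Proof.
move=> t0 s0 bA; have ts0 : 0 <= t + s by rewrite addr_ge0.
have bS := bounded_signal_shift t0 bA.
have solA := flow_solution ts0 bA.
have solS := solution_mulr bS (flow A t 0) (flow_solution s0 bS).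
rewrite mul1mx in solS.
suff solZ : solution (Defs.shift t A) s (flow A t 0) (fun r => flow A (t + r) 0).
  by apply: (solution_unique bS solZ solS); rewrite s0 lexx.
split.
  apply: (lipschitz_bounded_measurable (K := n%:R * c *
      (2 * `|1%:M : 'M[R]_n| * expR (growth_rate n c * (t + s))))) => //.
  move=> u v u0 uv vs.
  have -> : v - u = (t + v) - (t + u) by ring.
  by apply: (solution_lipschitz bA solA); rewrite ?addr_ge0// lerD2l.
move=> r /andP[r0 rs].
rewrite (@solution_step _ _ _ _ bA _ _ _ _ t (t + r) solA) ?lerD2l ?lerDl//.
congr (_ + _).
have sub : bounded_measurable `[t, t + r] (fun u => A u *m flow A u 0).
  apply: (bounded_measurable_field bA) => //.
  apply: bounded_measurableS solA.1 => //.
  by apply: subset_itv; rewrite bnd_simp ?lerD2l.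
have -> : `[t, t + r]%classic = `[t + 0, t + r]%classic by rewrite addr0.
rewrite -mxint_translation ?addr0//.
apply: eq_mxint => u; rewrite /= in_itv/= => /andP[u0 _].
by rewrite /Defs.shift u0.
Qed.

Lemma bounded_signal_concat A B c t : bounded_signal c A -> bounded_signal c B ->
  bounded_signal c (concat t A B).
Proof.
move=> [mA Ac] [mB Bc]; split=> [i j|s]; last by rewrite /concat; case: ifP.
rewrite (_ : (fun s => _) = (fun s => if s <= t then A s i j else B (- t + s) i j)); last first.
  by apply/funext => s; rewrite /concat [s - t]addrC; case: ifP.
apply: measurable_fun_ifT => //.
  by apply: measurable_fun_ler; [exact: measurable_id|exact: measurable_cst].
exact: (measurableT_comp (mB i j) (measurable_translation (- t))).
Qed.

Lemma flow_concat A B c s t : 0 <= s -> 0 <= t ->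
  bounded_signal c A -> bounded_signal c B ->
  flow (concat s A B) (s + t) 0 = flow B t 0 *m flow A s 0.
Proof.
move=> s0 t0 bA bB; have bC := bounded_signal_concat s bA bB.
have e1 : flow (Defs.shift s (concat s A B)) t 0 = flow B t 0.
  apply: (eq_flow t0 (bounded_signal_shift s0 bC) bB) => u /andP[u0 _].
  by rewrite /Defs.shift (ltW u0) /concat leNgt ltrDl u0 /= addrC addKr.
have e2 : flow (concat s A B) s 0 = flow A s 0.
  by apply: (eq_flow s0 bC bA) => u /andP[_ us]; rewrite /concat us.
by rewrite (flow_shift s0 t0 bC) e1 e2.
Qed.

(** The flows have some pointwise limit by boundedness. It solves the equation of [B] by
    [mxint_field_cvg], so uniqueness identifies it. *)
Lemma flow_cvg (U : set_system nat) (UU : UltraFilter U) (c : R)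
    (A : nat -> R -> 'M[R]_n) B T : 0 <= T ->
  (forall k, bounded_signal c (A k)) -> bounded_signal c B ->
  (forall i j g, mu.-integrable setT (EFin \o g) ->
    \int[mu]_t (g t * A k t i j) @[k --> U] --> \int[mu]_t (g t * B t i j)) ->
  flow (A k) T 0 @[k --> U] --> flow B T 0.
Proof.
move=> T0 bA bB AB.
pose X r : 'M[R]_n := lim (flow (A k) r 0 @[k --> U]).
have AX r : 0 <= r -> flow (A k) r 0 @[k --> U] --> X r.
  move=> r0.
  have [|L xL] := @ultra_cvg_mx R U UU _ _ (fun k => flow (A k) r 0)
    (2 * expR (growth_rate n c * r)).
    by move=> k; exact: flow_le.
  exact: (cvgP L).
have lipA k : lipschitz_on T (n%:R * c * (2 * `|1%:M : 'M[R]_n| * expR (growth_rate n c * T)))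
    (fun r => flow (A k) r 0).
  by move=> r s r0 rs sT; exact: (solution_lipschitz (bA k) (flow_solution T0 (bA k))).
have AX' r : 0 <= r <= T -> flow (A k) r 0 @[k --> U] --> X r.
  by move=> /andP[r0 _]; exact: AX.
rewrite (flowE T0 bB (X := X)); first exact: AX.
split.
  by apply: lipschitz_bounded_measurable T0 _; exact: equilipschitz_cvg lipA AX'.
move=> r rT.
have h : flow (A k) r 0 @[k --> U] -->
    1%:M + mxint `[0, r] (fun u => B u *m X u).
  under eq_fun do rewrite (flow_solution T0 (bA _)).2//.
  apply: cvgD; first exact: cvg_cst.
  exact: (mxint_field_cvg bA bB AB lipA AX').
exact: (cvg_unique (@norm_hausdorff _ _) (AX' _ rT) h).
Qed.

End Flow.

(** * Weak-star limits of bounded functions *)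

Section Density.
Variable R : realType.
Local Notation mu := (@lebesgue_measure R).
Local Notation w := (normal_pdf (0 : R) 1).
Local Notation P := (normal_prob (0 : R) 1).

Lemma normal_pdf_gt0 (t : R) : 0 < w t.
Proof.
by rewrite normal_pdfE ?oner_neq0// mulr_gt0 ?normal_peak_gt0 ?oner_neq0 ?expR_gt0.
Qed.

Lemma normal_pdf_integrable (E : set R) :
  measurable E -> mu.-integrable E (EFin \o w).
Proof.
by move=> mE; apply: (integrableS measurableT) => //; exact: integrable_normal_pdf.
Qed.

Lemma normal_prob_Rintegral (E : set R) : \int[mu]_(t in E) w t = fine (P E).
Proof. by []. Qed.

Section Charge.
Variables (L : set R -> R) (c : R).
Hypothesis c0 : 0 <= c.
Hypothesis LU : forall A B, measurable A -> measurable B -> [disjoint A & B] ->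
  L (A `|` B) = L A + L B.
Hypothesis Lc : forall E, measurable E -> `|L E| <= c * fine (P E).

Definition dominated_charge : set (measurableTypeR R) -> \bar R :=
  fun E => (L E)%:E.

Let L0 : L set0 = 0.
Proof.
apply/eqP; rewrite -normr_le0 (le_trans (Lc measurable0))//.
by rewrite measure0 mulr0.
Qed.

Let dominated_charge0 : dominated_charge set0 = 0%E.
Proof. by rewrite /dominated_charge L0. Qed.

Let dominated_charge_fin E : measurable E -> dominated_charge E \is a fin_num.
Proof. by []. Qed.

Let LbigU (F : (set R)^nat) n : (forall i, measurable (F i)) ->
  trivIset setT F ->
  L (\big[setU/set0]_(i < n) F i) = \sum_(0 <= i < n) L (F i).
Proof.
move=> mF tF; elim: n => [|n ih]; first by rewrite big_ord0 big_nil.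
rewrite big_ord_recr big_nat_recr//= LU ?ih//; first exact: bigsetU_measurable.
apply/disj_setPS => x; rewrite -bigcup_mkord => -[[i /= ilt Fix] Fnx].
by move: ilt; rewrite (tF i n)//; [rewrite ltnn|exists x].
Qed.

(** Finite additivity suffices: the defect of a partial union is the value on the remainder, at most
    [c] times its Gaussian probability, which tends to 0. *)
Let dominated_charge_sigma_additive : semi_sigma_additive dominated_charge.
Proof.
move=> F mF tF mUF; rewrite /dominated_charge.
under eq_fun do rewrite sumEFin -LbigU//.
apply: cvg_EFin; first exact: nearW.
pose B n := \big[setU/set0]_(i < n) F i.
have mB n : measurable (B n) by exact: bigsetU_measurable.
have BU n : B n `<=` \bigcup_k F k by exact: bigsetU_bigcup.
have PB : fine (P (B n)) @[n --> \oo] --> fine (P (\bigcup_k F k)).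
  apply: fine_cvg; rewrite fineK ?fin_num_measure//.
  have -> : \bigcup_k F k = \bigcup_k B k.
    rewrite -bigcup_bigsetU_bigcup; apply/seteqP; split=> [x [n _ h]|x [[|n] _ h]].
    - by exists n.+1.
    - by move: h; rewrite /B big_ord0.
    - by exists n.
  apply: nondecreasing_cvg_mu => //; first exact: bigcup_measurable.
  by move=> m n mn; apply/subsetPset; exact: subset_bigsetU.
have E n : L (\bigcup_k F k) - L (B n) = L (\bigcup_k F k `\` B n).
  have mD : measurable (\bigcup_k F k `\` B n) by exact: measurableD.
  have -> : L (\bigcup_k F k) = L (B n) + L (\bigcup_k F k `\` B n).
    rewrite -(LU (mB n) mD); last by apply/disj_setPS => x [? []].
    by congr L; rewrite setDUK.
  by rewrite addrC addKr.
apply/subr_cvg0; apply/norm_cvg0P.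
apply: (@squeeze_cvgr _ _ _ _ (cst 0) (fun n => c * (fine (P (\bigcup_k F k)) - fine (P (B n))))).
- apply: nearW => n; rewrite normr_ge0/= distrC E.
  have mD : measurable (\bigcup_k F k `\` B n) by exact: measurableD.
  rewrite (le_trans (Lc mD))//.
  rewrite ler_wpM2l// measureD//.
    rewrite (_ : \bigcup_k F k `&` B n = B n); last exact: setIidr.
    by rewrite fineB ?fin_num_measure.
  by rewrite ltey_eq fin_num_measure.
- exact: cvg_cst.
- rewrite -[X in _ --> X](mulr0 c); apply: cvgM; first exact: cvg_cst.
  by rewrite -[X in _ --> X](subrr (fine (P (\bigcup_k F k)))); apply: cvgB => //; exact: cvg_cst.
Qed.

HB.instance Definition _ := isCharge.Build _ _ _ dominated_charge
  dominated_charge0 dominated_charge_fin dominated_charge_sigma_additive.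

Let dominated_charge_null : dominated_charge `<< mu.
Proof.
apply/null_content_dominatesP => E mE mE0; rewrite /dominated_charge.
congr EFin; apply/eqP; rewrite -normr_le0 (le_trans (Lc mE))//.
rewrite /normal_prob null_set_integral ?mulr0//.
exact: (measurable_int mu (normal_pdf_integrable mE)).
Qed.

Lemma dominated_density0 : exists f : R -> R,
  mu.-integrable setT (EFin \o f) /\
  forall E, measurable E -> L E = \int[mu]_(t in E) f t.
Proof.
pose f := Radon_Nikodym dominated_charge mu.
have fE : EFin \o (fine \o f) = f.
  by apply/funext => t /=; rewrite fineK// Radon_Nikodym_fin_num.
exists (fine \o f); split.
  by rewrite fE; exact: Radon_Nikodym_integrable.
move=> E mE; rewrite /Rintegral.
have -> : (\int[mu]_(x in E) ((fine \o f) x)%:E = \int[mu]_(x in E) f x)%E.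
  by apply: eq_integral => x _; rewrite -[in RHS]fE.
by rewrite -Radon_Nikodym_integral.
Qed.

End Charge.

End Density.

Section BoundedDensity.
Variable R : realType.
Local Notation mu := (@lebesgue_measure R).
Local Notation w := (normal_pdf (0 : R) 1).
Local Notation P := (normal_prob (0 : R) 1).

Lemma measurable_normal_pdfV : measurable_fun setT (fun t : R => (w t)^-1).
Proof.
apply: continuous_measurable_fun => t; apply: cvgV.
  by rewrite gt_eqF// normal_pdf_gt0.
by apply: continuous_normal_pdf; rewrite oner_neq0.
Qed.

(** On the set [D] where the inequality fails, [f - c * w] is positive with a nonpositive integral,
    so it vanishes almost everywhere there. *)
Lemma density_ae_le (f : R -> R) (c : R) : 0 <= c ->
  mu.-integrable setT (EFin \o f) ->
  (forall E, measurable E -> \int[mu]_(t in E) f t <= c * fine (P E)) ->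
  {ae mu, forall t, f t <= c * w t}.
Proof.
move=> c0 fi fc; pose D := [set t | c * w t < f t].
have mf : measurable_fun setT f by apply/measurable_EFinP; exact: measurable_int fi.
have mw : measurable_fun setT w by exact: measurable_normal_pdf.
have mD : measurable D.
  rewrite (_ : D = ~` (setT `&` [set t | f t <= c * w t])).
    by apply: measurableC; apply: measurable_fun_le => //; exact: measurable_funM.
  by rewrite setTI; apply/seteqP; split=> t /=; rewrite /D /= ltNge => /negP.
have fD : mu.-integrable D (EFin \o f) by exact: integrableS fi.
have wD : mu.-integrable D (EFin \o w) by exact: normal_pdf_integrable.
have cwD : mu.-integrable D (EFin \o (fun t => c * w t)).
  exact: RintegrableZ.
have hD : mu.-integrable D (EFin \o (fun t => f t - c * w t)).
  exact: RintegrableB.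
have h0 : \int[mu]_(t in D) (f t - c * w t) <= 0.
  by rewrite RintegralB// RintegralZl// subr_le0 fc.
have : ae_eq mu D (EFin \o (fun t => f t - c * w t)) (cst 0%E).
  apply/ae_eq_integral_abs => //; first by exact: measurable_int hD.
  have -> : (\int[mu]_(t in D) `|(EFin \o (fun t => f t - c * w t)%R) t| =
      \int[mu]_(t in D) (f t - c * w t)%R%:E)%E.
    apply: eq_integral => t /set_mem /= Dt.
    by rewrite ger0_norm// subr_ge0 ltW.
  rewrite -[LHS]fineK; last exact: integrable_fin_num hD.
  congr EFin; apply/eqP; rewrite eq_le h0 Rintegral_ge0// => t Dt.
  by rewrite subr_ge0 ltW.
apply: filterS => t /= ht; rewrite leNgt; apply/negP => Dt.
have [] := ht Dt => /eqP; rewrite subr_eq0 => /eqP E.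
by move: Dt; rewrite E ltxx.
Qed.

Lemma dominated_density (L : set R -> R) (c : R) : 0 <= c ->
  (forall A B, measurable A -> measurable B -> [disjoint A & B] ->
    L (A `|` B) = L A + L B) ->
  (forall E, measurable E -> `|L E| <= c * fine (P E)) ->
  exists b : R -> R, [/\ measurable_fun setT b, forall t, `|b t| <= c &
    forall E, measurable E -> L E = \int[mu]_(t in E) (b t * w t)].
Proof.
move=> c0 LU Lc; have [f [fi Lf]] := dominated_density0 c0 LU Lc.
have mf : measurable_fun setT f by apply/measurable_EFinP; exact: measurable_int fi.
have mw : measurable_fun setT w by exact: measurable_normal_pdf.
pose D := [set t | `|f t| <= c * w t].
have mD : measurable D.
  rewrite /D -[X in measurable X]setTI.
  by apply: measurable_fun_le => //; [exact: measurableT_comp|exact: measurable_funM].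
(* The indicator resets the density to 0 on the null set where it exceeds its bound, so that the
   bound [c] holds everywhere. *)
exists (fun t => f t / w t * \1_D t); split.
- apply: measurable_funM; last exact: measurable_indic.
  by apply: measurable_funM => //; exact: measurable_normal_pdfV.
- move=> t; rewrite indicE; case: (boolP (t \in D)) => [/set_mem Dt|_]; last first.
    by rewrite mulr0 normr0.
  rewrite mulr1 normrM normfV (gtr0_norm (normal_pdf_gt0 t)).
  by rewrite ler_pdivrMr ?normal_pdf_gt0.
move=> E mE; rewrite Lf//; congr fine.
have fE : {ae mu, forall t, f t <= c * w t}.
  apply: density_ae_le => // A mA; rewrite -Lf//.
  by rewrite (le_trans (ler_norm _))// Lc.
have fNE : {ae mu, forall t, - f t <= c * w t}.
  apply: density_ae_le => //.
    exact: RintegrableN.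
  move=> A mA.
  have -> : \int[mu]_(t in A) - f t = - L A.
    by rewrite Lf// RintegralN//; exact: integrableS fi.
  by rewrite (le_trans (ler_norm _))// normrN Lc.
apply: ae_eq_integral => //.
- by apply/measurable_EFinP; exact: measurable_funTS.
- apply/measurable_EFinP; apply: measurable_funTS.
  apply: measurable_funM => //.
  apply: measurable_funM; last exact: measurable_indic.
  by apply: measurable_funM => //; exact: measurable_normal_pdfV.
apply: (@filterS2 _ _ (ae_filter_ringOfSetsType mu) _ _ _ _ fE fNE).
move=> t ft fNt _ /=; congr EFin.
have Dt : t \in D by apply/mem_set; rewrite /D /= ler_norml ft lerNl fNt.
by rewrite indicE Dt mulr1 divfK// gt_eqF// normal_pdf_gt0.
Qed.

End BoundedDensity.

(** * Weak-star compactness of bounded scalar functions *)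

Section WeakStarLimit.
Variables (R : realType) (U : set_system nat).
Context {UU : UltraFilter U}.
Local Notation mu := (@lebesgue_measure R).
Local Notation w := (normal_pdf (0 : R) 1).
Local Notation P := (normal_prob (0 : R) 1).
Variables (a : nat -> R -> R) (c : R).
Hypothesis ma : forall k, measurable_fun setT (a k).
Hypothesis ac : forall k t, `|a k t| <= c.

Let c0 : 0 <= c. Proof. exact: le_trans (normr_ge0 _) (ac 0 0). Qed.

Let intwa k (E : set R) : measurable E ->
  mu.-integrable E (EFin \o (fun t => w t * a k t)).
Proof.
move=> mE; apply: (@Rintegrable_mulb R E mE w (a k) c) => //.
  exact: normal_pdf_integrable.
exact: measurable_funTS.
Qed.

Let I k (E : set R) := \int[mu]_(t in E) (w t * a k t).

Let I_le k E : measurable E -> `|I k E| <= c * fine (P E).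
Proof.
move=> mE; rewrite -normal_prob_Rintegral -RintegralZl//; last first.
  exact: normal_pdf_integrable.
apply: Rintegral_le_bound => //; first exact: intwa.
  by apply: RintegrableZ => //; exact: normal_pdf_integrable.
move=> t _; rewrite normrM (ger0_norm (normal_pdf_ge0 _ _ _)) mulrC.
by rewrite ler_wpM2r// normal_pdf_ge0.
Qed.

Let L (E : set R) : R := lim (I k E @[k --> U]).

Let I_cvg E : measurable E -> I k E @[k --> U] --> L E.
Proof.
move=> mE; have [l Il] := @ultra_cvg_real R U UU (I ^~ E) _ (fun k => I_le k mE).
by apply: (@cvgP _ (I k E @[k --> U])); exact: Il.
Qed.

Let L_add A B : measurable A -> measurable B -> [disjoint A & B] ->
  L (A `|` B) = L A + L B.
Proof.
move=> mA mB AB; have mAB : measurable (A `|` B) by exact: measurableU.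
apply: (@cvg_unique _ _ (I k (A `|` B) @[k --> U])) => //; first exact: I_cvg.
have -> : (fun k => I k (A `|` B)) = (fun k => I k A + I k B).
  by apply/funext => k; rewrite /I Rintegral_setU//; exact: intwa.
by apply: cvgD; exact: I_cvg.
Qed.

Let L_le E : measurable E -> `|L E| <= c * fine (P E).
Proof.
move=> mE; apply: (@cvgr_to_le nat U _ R (fun k => `|I k E|)).
  by apply: cvg_norm; exact: I_cvg.
by apply: nearW => k; exact: I_le.
Qed.

(** The test functions for which the limit is correct. They are shown to be all of L1 by the usual
    induction: weighted indicators, weighted simple functions, nonnegative functions,
    differences. *)
Let good (b g : R -> R) := mu.-integrable setT (EFin \o g) /\
  \int[mu]_t (g t * a k t) @[k --> U] --> \int[mu]_t (g t * b t).

Section Test.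
Import HBSimple HBNNSimple.
Variable b : R -> R.
Hypothesis mb : measurable_fun setT b.
Hypothesis bc : forall t, `|b t| <= c.
Hypothesis Lb : forall E, measurable E -> L E = \int[mu]_(t in E) (b t * w t).

Let ia g k : mu.-integrable setT (EFin \o g) ->
  mu.-integrable setT (EFin \o (fun t => g t * a k t)).
Proof. by move=> gi; exact: (@Rintegrable_mulb R setT measurableT g _ c). Qed.

Let ib g : mu.-integrable setT (EFin \o g) ->
  mu.-integrable setT (EFin \o (fun t => g t * b t)).
Proof. by move=> gi; exact: (@Rintegrable_mulb R setT measurableT g _ c). Qed.

Let goodD g h : good b g -> good b h -> good b (fun t => g t + h t).
Proof.
move=> [gi gl] [hi hl]; split; first exact: RintegrableD.
have E (f : R -> R) : mu.-integrable setT (EFin \o (fun t => g t * f t)) ->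
    mu.-integrable setT (EFin \o (fun t => h t * f t)) ->
    \int[mu]_t ((g t + h t) * f t) =
    \int[mu]_t (g t * f t) + \int[mu]_t (h t * f t).
  move=> gf hf; rewrite -RintegralD//.
  by apply: eq_Rintegral => t _; rewrite mulrDl.
rewrite E ?ib//; under eq_fun do rewrite E ?ia//.
exact: cvgD.
Qed.

Let goodZ r g : good b g -> good b (fun t => r * g t).
Proof.
move=> [gi gl]; split; first exact: RintegrableZ.
have E (f : R -> R) : mu.-integrable setT (EFin \o (fun t => g t * f t)) ->
    \int[mu]_t (r * g t * f t) = r * \int[mu]_t (g t * f t).
  move=> gf; rewrite -RintegralZl//.
  by apply: eq_Rintegral => t _; rewrite mulrA.
rewrite E ?ib//; under eq_fun do rewrite E ?ia//.
by apply: cvgM => //; exact: cvg_cst.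
Qed.

Let good_indic E : measurable E -> good b (fun t => w t * \1_E t).
Proof.
move=> mE; split.
  apply: (@Rintegrable_mulb R setT measurableT w _ 1) => //.
    exact: normal_pdf_integrable.
  by move=> t _; rewrite indicE; case: (t \in E); rewrite ?normr1 ?normr0.
have H (f : R -> R) :
    \int[mu]_t (w t * \1_E t * f t) = \int[mu]_(t in E) (w t * f t).
  rewrite [RHS]Rintegral_mkcond; apply: eq_Rintegral => t _.
  by rewrite patchE indicE; case: (t \in E); rewrite ?mulr1// mulr0 mul0r.
rewrite H; under eq_fun do rewrite H.
have -> : \int[mu]_(t in E) (w t * b t) = L E.
  by rewrite Lb//; apply: eq_Rintegral => t _; rewrite mulrC.
exact: I_cvg.
Qed.

Let good_fimfun (s : {sfun R >-> R}) : good b (fun t => w t * s t).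
Proof.
have -> : (fun t => w t * s t) =
    (fun t => \sum_(x <- finmap.enum_fset (fset_set (range s))) x * (w t * \1_(s @^-1` [set x]) t)).
  apply/funext => t; rewrite [in LHS]fimfunE fsbig_finite//= mulr_sumr.
  by apply: eq_bigr => x _; rewrite mulrCA.
elim: (finmap.enum_fset (fset_set (range s))) => [|x l ih].
  under eq_fun do rewrite big_nil.
  split; first exact: integrable0.
  have E (f : R -> R) : \int[mu]_t (0 * f t) = 0.
    by under eq_Rintegral do rewrite mul0r; rewrite /Rintegral integral0.
  by rewrite E; under eq_fun do rewrite E; exact: cvg_cst.
under eq_fun do rewrite big_cons.
by apply: goodD => //; apply: goodZ; exact: good_indic.
Qed.

(** Closedness in L1: since all [a k] and [b] are bounded by [c], replacing [g] by a close [s n]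
    costs at most [e / 3] uniformly in [k]. *)
Let good_lim (g : R -> R) (s : nat -> R -> R) :
  mu.-integrable setT (EFin \o g) -> (forall n, good b (s n)) ->
  \int[mu]_t `|s n t - g t| @[n --> \oo] --> 0 -> good b g.
Proof.
move=> gi sg sl; split=> //; apply/cvgrPdist_le => e e0.
have e'0 : 0 < e / 3 / (c + 1) by rewrite !divr_gt0// ltr_wpDl.
have : \forall n \near \oo, `|\int[mu]_t `|s n t - g t| | <= e / 3 / (c + 1).
  by move/cvgr0Pnorm_le : sl; exact.
move=> [n _ /(_ n (leqnn n)) /= sn].
have [si snl] := sg n.
have dec (f : R -> R) : measurable_fun setT f -> (forall t, `|f t| <= c) ->
    `|\int[mu]_t (s n t * f t) - \int[mu]_t (g t * f t)| <= e / 3.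
  move=> mf fc.
  have sfi := @Rintegrable_mulb R setT measurableT _ _ c si mf (fun t _ => fc t).
  have gfi := @Rintegrable_mulb R setT measurableT _ _ c gi mf (fun t _ => fc t).
  have di := RintegrableB measurableT si gi.
  rewrite -RintegralB//.
  apply: (@le_trans _ _ (c * \int[mu]_t `|s n t - g t|)).
    rewrite -RintegralZl//; last exact: integrable_norm.
    apply: Rintegral_le_bound => //; first exact: RintegrableB.
      by apply: RintegrableZ => //; exact: integrable_norm.
    by move=> t _; rewrite -mulrBl normrM mulrC ler_wpM2r.
  apply: (@le_trans _ _ ((c + 1) * \int[mu]_t `|s n t - g t|)).
    by rewrite ler_wpM2r ?lerDl//; apply: Rintegral_ge0 => t _; exact: normr_ge0.
  rewrite -ler_pdivlMl ?ltr_wpDl// mulrC.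
  by rewrite (le_trans (ler_norm _)).
have : \forall k \near U, `|\int[mu]_t (s n t * b t) - \int[mu]_t (s n t * a k t)| <= e / 3.
  by move/cvgrPdist_le : snl; apply; rewrite divr_gt0.
apply: filterS => k sk.
have := dec b mb bc; have := dec (a k) (ma k) (ac k); move: sk.
rewrite !ler_norml => /andP[? ?] /andP[? ?] /andP[? ?]; apply/andP; split; lra.
Qed.

Let good_ge0 (g : R -> R) : mu.-integrable setT (EFin \o g) ->
  (forall t, 0 <= g t) -> good b g.
Proof.
move=> gi g0.
have mg : measurable_fun setT g by apply/measurable_EFinP; exact: measurable_int gi.
(* The known test functions carry the weight [w], so simple functions approximate [g / w] from
   below, and dominated convergence gives [w * s n --> g] in L1. *)
pose h t := (g t / w t)%:E.
have mh : measurable_fun setT h.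
  apply/measurable_EFinP; apply: measurable_funM => //.
  exact: measurable_normal_pdfV.
have h0 t : (0 <= h t)%E by rewrite lee_fin divr_ge0// normal_pdf_ge0.
pose s n := nnsfun_approx measurableT mh n.
have sh n t : w t * s n t <= g t.
  have : ((s n t)%:E <= h t)%E by rewrite /s nnsfun_approxE; exact: le_approx.
  by rewrite lee_fin ler_pdivlMr ?normal_pdf_gt0// mulrC.
have gs n : good b (fun t => w t * s n t) := good_fimfun (s n).
apply: (good_lim gi gs).
have mws n : measurable_fun setT (fun t => w t * s n t).
  by apply: measurable_funM; [exact: measurable_normal_pdf|exact: measurable_funP].
have [] := @dominated_convergence _ _ _ mu setT measurableT
  (fun n => EFin \o (fun t => w t * s n t)) (EFin \o g) (EFin \o g).
- by move=> n; apply/measurable_EFinP; exact: mws.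
- by apply/measurable_EFinP.
- apply: aeW => t _.
  have sl : EFin \o s^~ t @ \oo --> h t by exact: cvg_nnsfun_approx.
  have := cvgeZl (isT : (w t)%:E \is a fin_num) sl.
  rewrite /h -EFinM mulrCA divff ?mulr1; last by rewrite gt_eqF// normal_pdf_gt0.
  by [].
- exact: gi.
- apply: aeW => t n _ /=; rewrite lee_fin ger0_norm// mulr_ge0// normal_pdf_ge0//.
- move=> _ + _ => H.
  by apply: fine_cvg.
Qed.

Lemma weakstar_limit_test (g : R -> R) : mu.-integrable setT (EFin \o g) ->
  \int[mu]_t (g t * a k t) @[k --> U] --> \int[mu]_t (g t * b t).
Proof.
move=> gi.
have gp : good b g^\+.
  by apply: good_ge0 => //; exact: integrable_funrpos.
have gn : good b g^\-.
  by apply: good_ge0 => //; exact: integrable_funrneg.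
have gE : (fun t => g^\+ t + -1 * g^\- t) = g.
  by apply/funext => t; rewrite mulN1r -[in RHS](funrposBneg g).
by have := goodD gp (goodZ (-1) gn); rewrite gE => -[].
Qed.

End Test.

Theorem bounded_weakstar_limit : exists b : R -> R,
  [/\ measurable_fun setT b, forall t, `|b t| <= c &
      forall g, mu.-integrable setT (EFin \o g) ->
        \int[mu]_t (g t * a k t) @[k --> U] --> \int[mu]_t (g t * b t)].
Proof.
have [b [mb bc Lb]] := dominated_density c0 L_add L_le.
by exists b; split=> // g; exact: weakstar_limit_test.
Qed.

End WeakStarLimit.

(** * Norms and growth rate *)

Section NormEquivalence.
Variables (R : realType) (n : nat) (N : 'cV[R]_n -> R).
Hypothesis nN : is_norm N.

Let ND x y : N (x + y) <= N x + N y. Proof. by have [+ _ _] := nN; apply. Qed.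
Let NZ a x : N (a *: x) = `|a| * N x. Proof. by have [_ + _] := nN; apply. Qed.

Lemma is_norm0 : N 0 = 0.
Proof. by rewrite -[0](scale0r (0 : 'cV[R]_n)) NZ normr0 mul0r. Qed.

Lemma is_norm_ge0 x : 0 <= N x.
Proof.
have := ND x (- x); rewrite subrr is_norm0 -scaleN1r NZ normrN1 mul1r.
by rewrite -mulr2n pmulrn_lge0.
Qed.

Let N_upper : exists2 b, 0 < b & forall x, N x <= b * `|x|.
Proof.
pose e i : 'cV[R]_n := delta_mx i 0.
exists (\sum_i N (e i) + 1).
  by rewrite ltr_wpDl// sumr_ge0// => i _; exact: is_norm_ge0.
move=> x; rewrite mulrDl mul1r.
apply: (@le_trans _ _ ((\sum_i N (e i)) * `|x|)); last by rewrite lerDl.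
have {1}-> : x = \sum_i x i 0 *: e i.
  by rewrite [LHS]matrix_sum_delta; apply: eq_bigr => i _; rewrite big_ord1.
rewrite mulr_suml; elim/big_ind2 : _ => [|a b c d ab cd|i _].
- by rewrite is_norm0.
- by rewrite (le_trans (ND _ _))// lerD.
- by rewrite NZ mulrC ler_wpM2l ?is_norm_ge0// mx_norm_entry.
Qed.

(** Otherwise there are vectors of max norm 1 with [N] tending to 0. Their limit has max norm 1, and
    [N_upper] makes [N] vanish at it. *)
Let N_lower : exists2 a, 0 < a & forall x, `|x| <= a * N x.
Proof.
have [b b0 Nb] := N_upper; have [U [UU Uoo]] := free_ultrafilter.
apply: contrapT => nex.
have H k : exists x : 'cV[R]_n, `|x| = 1 /\ N x <= k.+1%:R^-1.
  apply: contrapT => nk; apply: nex; exists k.+1%:R => // x.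
  have [->|x0] := eqVneq x 0; first by rewrite normr0 mulr_ge0// is_norm_ge0.
  have nx0 : 0 < `|x| by rewrite normr_gt0.
  rewrite leNgt; apply/negP => lt; apply: nk; exists (`|x|^-1 *: x); split.
    by rewrite normrZ ger0_norm ?invr_ge0// mulVf// gt_eqF.
  rewrite NZ ger0_norm ?invr_ge0// ler_pdivrMl// ler_pdivlMr// mulrC.
  exact: ltW.
have [x xP] := choice H.
have [|L xL] := @ultra_cvg_mx R U UU _ _ x 1; first by move=> k; rewrite (xP k).1.
have L1 : `|L| = 1.
  apply: (@cvg_unique _ _ (`|x k| @[k --> U])) => //; first exact: cvg_norm.
  rewrite (_ : (fun k => `|x k|) = fun=> 1); first exact: cvg_cst.
  by apply/funext => k; rewrite (xP k).1.
suff : N L <= 0.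
  move=> NL; have [_ _ /(_ L) N0] := nN.
  have /N0 L0 : N L = 0 by apply/eqP; rewrite eq_le NL is_norm_ge0.
  by move/eqP : L1; rewrite L0 normr0 eq_sym oner_eq0.
apply/ler_addgt0Pl => e e0; rewrite addr0.
have near1 : \forall k \near U, `|L - x k| <= e / 2 / b.
  by move/cvgrPdist_le : xL; apply; rewrite !divr_gt0.
have near2 : \forall k \near U, k.+1%:R^-1 <= e / 2 :> R.
  apply: Uoo; have e2 : 0 < e / 2 by rewrite divr_gt0.
  have : \forall k \near \oo, `|@harmonic R k| <= e / 2.
    by move/cvgr0Pnorm_le : (@cvg_harmonic R); exact.
  by move=> [m _ mP]; exists m => // k /mP /=; rewrite ger0_norm.
have [k [h1 h2]] := @filter_ex _ U _ _ (filterI near1 near2).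
have -> : L = (L - x k) + x k by rewrite subrK.
rewrite (le_trans (ND _ _))// [e]splitr lerD//.
  by rewrite (le_trans (Nb _))// -ler_pdivlMl// mulrC.
by rewrite (le_trans (xP k).2).
Qed.

(** Guarantees that the [sup] in [opnorm] is a genuine supremum and not the default value. *)
Lemma opnorm_has_sup (P : 'M[R]_n) :
  has_sup [set N (P *m x) | x in [set x | N x <= 1]].
Proof.
have [b b0 Nb] := N_upper; have [a a0 Na] := N_lower; split.
  by exists (N (P *m 0)), 0 => //=; rewrite is_norm0.
exists (b * (n%:R * `|P| * (a * 1))) => _ [x /= x1 <-].
rewrite (le_trans (Nb _))// ler_wpM2l ?(ltW b0)//.
rewrite (le_trans (mx_norm_mul _ _))// ler_wpM2l//.
by rewrite (le_trans (Na _))// ler_wpM2l// ltW.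
Qed.

Lemma norm_equivalence : exists2 a : R, 1 <= a &
  (forall x, N x <= a * `|x| /\ `|x| <= a * N x) /\
  (forall P, opnorm N P <= a * `|P| /\ `|P| <= a * opnorm N P).
Proof.
have [b b0 Nb] := N_upper; have [a a0 Na] := N_lower.
have up P : opnorm N P <= b * n%:R * a * `|P|.
  apply: ge_sup; first exact: (opnorm_has_sup P).1.
  move=> _ [x /= x1 <-].
  rewrite (le_trans (Nb _))// -!mulrA ler_wpM2l ?(ltW b0)//.
  rewrite (le_trans (mx_norm_mul _ _))// -mulrA ler_wpM2l//.
  rewrite [a * _]mulrC ler_wpM2l//.
  by rewrite (le_trans (Na _))// ger_pMr.
have down P : `|P| <= a * b * opnorm N P.
  have op0 : 0 <= opnorm N P.
    apply: (@le_trans _ _ (N (P *m 0))); first exact: is_norm_ge0.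
    by apply: ub_le_sup; [exact: (opnorm_has_sup P).2|exists 0 => //=; rewrite is_norm0].
  apply: mx_norm_le => [|i j]; first by rewrite !mulr_ge0// ltW.
  (* A basis vector scaled into the unit ball of [N], so that [opnorm] controls the [j]-th column of
     [P]. *)
  pose e : 'cV[R]_n := b^-1 *: delta_mx j 0.
  have Ne : N e <= 1.
    rewrite NZ ger0_norm ?invr_ge0 ?(ltW b0)// ler_pdivrMl// mulr1.
    rewrite (le_trans (Nb _))// ger_pMr//; apply: mx_norm_le => // k l.
    by rewrite mxE; case: (_ && _); rewrite ?normr1 ?normr0.
  have Pe : (P *m e) i 0 = b^-1 * P i j.
    by rewrite /e -scalemxAr -colE !mxE.
  have -> : P i j = b * (P *m e) i 0 by rewrite Pe mulrA divff ?mul1r// gt_eqF.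
  rewrite normrM (gtr0_norm b0) [a * b]mulrC -mulrA ler_wpM2l ?(ltW b0)//.
  rewrite (le_trans (mx_norm_entry _ _ _))// (le_trans (Na _))// ler_wpM2l ?(ltW a0)//.
  by apply: ub_le_sup; [exact: (opnorm_has_sup P).2|exists e].
exists (1 + a + b + b * n%:R * a + a * b).
  by rewrite -!addrA lerDl !addr_ge0 ?mulr_ge0// ltW.
have le1 z u v : 0 <= v -> u <= z * v -> z \in [:: a; b; b * n%:R * a; a * b] ->
    u <= (1 + a + b + b * n%:R * a + a * b) * v.
  move=> v0 uzv zin; rewrite (le_trans uzv)// ler_wpM2r//.
  have h1 : 0 <= b * n%:R * a by rewrite !mulr_ge0// ltW.
  have h2 : 0 <= a * b by rewrite mulr_ge0// ltW.
  by move: zin; rewrite !inE => /or4P[] /eqP ->; lra.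
split=> [x|P]; split.
- by apply: (le1 b); rewrite ?inE ?eqxx ?orbT.
- by apply: (le1 a); rewrite ?inE ?eqxx ?orbT ?is_norm_ge0.
- by apply: (le1 (b * n%:R * a)); rewrite ?inE ?eqxx ?orbT.
- apply: (le1 (a * b)); rewrite ?inE ?eqxx ?orbT//.
  have : 0 <= a * b * opnorm N P by rewrite (le_trans _ (down P)).
  by rewrite pmulr_rge0// mulr_gt0.
Qed.

End NormEquivalence.

(** * The growth rate as an exponential rate *)

Section GrowthRate.
Variables (R : realType) (n : nat) (N : 'cV[R]_n -> R).
Variables (S : set (R -> 'M[R]_n)) (c : R).
Hypothesis n0 : (0 < n)%N.
Hypothesis nN : is_norm N.
Hypothesis bS : forall A, S A -> bounded_signal c A.
Hypothesis S0 : S !=set0.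
Local Notation l := (growth_rate n c).

Let limsup : \bar R := limf_esup (fun t : R =>
  ereal_sup [set ((opnorm N (flow A t 0)) `^ t^-1)%:E | A in S]) +oo%R.

Let limsup_le (B k : R) :
  (forall A t, S A -> 0 <= t -> `|flow A t 0| <= B * expR (k * t)) ->
  (limsup <= (expR k)%:E)%E.
Proof.
move=> SB; have [a a1 [_ aP]] := norm_equivalence nN.
have a0 : 0 <= a by exact: le_trans a1.
apply/lee_addgt0Pr => e e0; rewrite -EFinD.
pose d := ln (expR k + e) - k.
have ek : 0 < expR k + e by rewrite addr_gt0// expR_gt0.
have d0 : 0 < d.
  by rewrite subr_gt0 -[ltLHS]expRK ltr_ln ?posrE ?expR_gt0// ltrDl.
have kd : expR (k + d) = expR k + e by rewrite /d addrC subrK lnK.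
(* Beyond this time [a * B <= 1 + d * t <= expR (d * t)]: the prefactor is absorbed by a rate
   increase of [d]. *)
pose M := Num.max 0 (a * B / d).
apply: (@le_trans _ _ (ereal_sup ((fun t : R =>
  ereal_sup [set ((opnorm N (flow A t 0)) `^ t^-1)%:E | A in S]) @` [set t | M < t]))).
  apply: ereal_inf_lbound; exists [set t | M < t] => //.
  by exists M; split; [exact: num_real|].
apply: ge_ereal_sup => _ [t /= Mt <-]; apply: ge_ereal_sup => _ [A SA <-].
move: Mt; rewrite gt_max => /andP[t0 abt].
rewrite lee_fin -kd.
have -> : expR (k + d) = expR ((k + d) * t) `^ t^-1.
  by rewrite -expRM mulfK// gt_eqF.
apply: ge0_ler_powR.
- by rewrite invr_ge0 ltW.
- rewrite nnegrE.
  have : 0 <= a * opnorm N (flow A t 0) by rewrite (le_trans _ (aP _).2).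
  by rewrite pmulr_rge0// (lt_le_trans _ a1).
- by rewrite nnegrE expR_ge0.
rewrite (le_trans (aP _).1)//.
apply: (@le_trans _ _ (a * (B * expR (k * t)))).
  by rewrite ler_wpM2l// SB// ltW.
rewrite mulrA mulrDl expRD mulrC ler_wpM2l ?expR_ge0//.
rewrite (le_trans _ (expR_ge1Dx _))//.
by move: abt; rewrite ltr_pdivrMr// => abt; lra.
Qed.

Let limsup_ge (b k : R) : 0 < b ->
  (forall T, exists t A, [/\ T < t, S A & b * expR (k * t) <= `|flow A t 0|]) ->
  ((expR k)%:E <= limsup)%E.
Proof.
move=> b0 SB; have [a a1 [_ aP]] := norm_equivalence nN.
have a0 : 0 < a by exact: lt_le_trans a1.
apply/lee_addgt0Pr => e e0.
(* By [1 + x <= expR x], lowering the rate by this [d] lowers [expR k] by at most [e]. *)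
pose d := e / expR k.
have d0 : 0 < d by rewrite divr_gt0// expR_gt0.
apply: (@le_trans _ _ ((expR (k - d))%:E + e%:E)%E).
  rewrite -EFinD lee_fin -lerBlDr expRD.
  have -> : expR k - e = expR k * (1 + - d).
    by rewrite mulrDr mulr1 mulrN /d mulrCA divff ?mulr1// gt_eqF// expR_gt0.
  by rewrite ler_wpM2l ?expR_ge0// expR_ge1Dx.
apply: leeD => //; apply: le_ereal_inf_tmp => _ [V [M [_ MV]] <-].
have [t [A [tT SA At]]] := SB (Num.max M (Num.max 0 (a / b / d))).
move: tT; rewrite !gt_max => /and3P[Mt t0 abt].
apply: (@le_trans _ _ ((opnorm N (flow A t 0)) `^ t^-1)%:E); last first.
  apply: (@le_trans _ _ (ereal_sup [set ((opnorm N (flow A t 0)) `^ t^-1)%:E | A in S])).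
    by apply: ereal_sup_ubound; exists A.
  by apply: ereal_sup_ubound; exists t => //; exact: MV.
rewrite lee_fin.
have -> : expR (k - d) = expR ((k - d) * t) `^ t^-1.
  by rewrite -expRM mulfK// gt_eqF.
have op0 : 0 <= opnorm N (flow A t 0).
  have : 0 <= a * opnorm N (flow A t 0) by rewrite (le_trans _ (aP _).2).
  by rewrite pmulr_rge0.
apply: ge0_ler_powR.
- by rewrite invr_ge0 ltW.
- by rewrite nnegrE expR_ge0.
- by rewrite nnegrE.
rewrite -(ler_pM2l a0) (le_trans _ (aP _).2)// (le_trans _ At)//.
rewrite mulrDl expRD mulrCA [b * _]mulrC ler_wpM2l ?expR_ge0//.
rewrite mulNr expRN ler_pdivrMr ?expR_gt0// -ler_pdivrMl// mulrC.
rewrite (le_trans _ (expR_ge1Dx _))//.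
by move: abt; rewrite ltr_pdivrMr// => abt; lra.
Qed.

Lemma flow_norm_ge A t : S A -> 0 <= t -> (2 * n%:R)^-1 * expR (- l * t) <= `|flow A t 0|.
Proof.
move=> SA t0; pose x : 'cV[R]_n := const_mx 1.
have x1 : `|x| = 1.
  apply/eqP; rewrite eq_le; apply/andP; split.
    by apply: mx_norm_le => // i j; rewrite mxE normr1.
  have := mx_norm_entry x (Ordinal n0) 0.
  by rewrite mxE normr1.
have := flow_ge x t0 (bS SA); rewrite x1 => h.
have e0 : 0 < expR (l * t) by exact: expR_gt0.
rewrite mulNr expRN -invfM -[leLHS]mulr1 ler_pdivrMl ?mulr_gt0 ?ltr0n//.
rewrite (le_trans h)//.
have := mx_norm_mul (flow A t 0) x; rewrite x1 mulr1 => h2.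
rewrite [2 * n%:R * _]mulrAC -[leRHS]mulrA ler_wpM2l//.
Qed.

(** Finiteness makes [fine] faithful in [rho], and positivity gives a meaning to [ln (rho N S)], the
    exponent used from here on. *)
Let limsup_bounds : ((expR (- l))%:E <= limsup <= (expR l)%:E)%E.
Proof.
apply/andP; split.
  apply: (@limsup_ge (2 * n%:R)^-1); first by rewrite invr_gt0 mulr_gt0// ltr0n.
  move=> T; have [A SA] := S0; exists (Num.max 0 T + 1), A; split=> //.
    by rewrite ltr_pwDr// le_max lexx orbT.
  by apply: flow_norm_ge => //; rewrite addr_ge0// le_max lexx.
by apply: (@limsup_le 2) => A t SA t0; exact: flow_le t0 (bS SA).
Qed.

Let rhoE : (rho N S)%:E = limsup.
Proof.
rewrite /rho fineK// fin_numE; have /andP[h1 h2] := limsup_bounds.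
apply/andP; split; apply/eqP => E.
  by move: h1; rewrite /limsup E leeNy_eq.
by move: h2; rewrite /limsup E leye_eq.
Qed.

Lemma rho_gt0 : 0 < rho N S.
Proof.
rewrite (lt_le_trans (expR_gt0 (- l)))//.
by rewrite -lee_fin rhoE; have /andP[] := limsup_bounds.
Qed.

Lemma ln_rho_le (B k : R) :
  (forall A t, S A -> 0 <= t -> `|flow A t 0| <= B * expR (k * t)) ->
  ln (rho N S) <= k.
Proof.
move=> /limsup_le; rewrite -rhoE lee_fin => h.
by rewrite -ler_expR lnK// posrE rho_gt0.
Qed.

Lemma ln_rho_ge (b k : R) : 0 < b ->
  (forall T, exists t A, [/\ T < t, S A & b * expR (k * t) <= `|flow A t 0|]) ->
  k <= ln (rho N S).
Proof.
move=> b0 /(limsup_ge b0); rewrite -rhoE lee_fin => h.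
by rewrite -ler_expR lnK// posrE rho_gt0.
Qed.

Lemma powR_rho t : rho N S `^ t = expR (ln (rho N S) * t).
Proof. by rewrite expRM lnK// posrE rho_gt0. Qed.

Hypothesis shS : shift_invariant S.

Local Notation la := (ln (rho N S)).

(* Otherwise submultiplicativity over multiples of [t] would make the growth
   exponent at most [la - ln 2 / t]. *)
Lemma rho_attained t : 0 < t ->
  exists2 A, S A & expR (la * t) / 2 <= n%:R * `|flow A t 0|.
Proof.
move=> t0; apply: contrapT => nA.
have small A : S A -> n%:R * `|flow A t 0| <= expR (la * t) / 2.
  move=> SA; rewrite leNgt; apply/negP => h; apply: nA; exists A => //.
  exact: ltW.
pose k := la - ln 2 / t.
have kt : expR (la * t) / 2 = expR (k * t).
  rewrite /k mulrBl divfK ?gt_eqF// expRD expRN lnK// posrE//.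
have step j A s : S A -> 0 <= s ->
    `|flow A (j%:R * t + s) 0| <= expR (k * t) ^+ j * (2 * expR (l * s)).
  elim: j A => [|j ih] A SA s0.
    by rewrite mul0r add0r expr0 mul1r; exact: flow_le s0 (bS SA).
  have js0 : 0 <= j%:R * t + s by rewrite addr_ge0// mulr_ge0// ltW.
  have -> : j.+1%:R * t + s = t + (j%:R * t + s).
    by rewrite -natr1 mulrDl mul1r addrAC addrC.
  rewrite (flow_shift (ltW t0) js0 (bS SA)) (le_trans (mx_norm_mul _ _))//.
  rewrite exprS [leLHS]mulrAC -[leRHS]mulrA ler_pM// ?mulr_ge0//.
    by rewrite -kt small.
  by apply: ih => //; apply: shS => //; exact: ltW.
have : la <= k.
  (* With [u = j * t + s] and [0 <= s <= t], the first factor bounds the flow over the remainder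
     [s], and the last one accounts for the [k * s] missing from the exponent. *)
  apply: (@ln_rho_le (2 * expR (l * t) * expR (`|k| * t))) => A u SA u0.
  pose j := Num.truncn (u / t).
  have ut0 : 0 <= u / t by rewrite divr_ge0// ltW.
  have /andP[ju uj] := Num.Theory.truncn_itv ut0.
  pose s := u - j%:R * t.
  have s0 : 0 <= s by rewrite subr_ge0 -ler_pdivlMr.
  have st : s <= t.
    rewrite lerBlDl (_ : _ + t = j.+1%:R * t) -?ler_pdivrMr//; first exact: ltW.
    by rewrite -addn1 natrD mulrDl mul1r.
  have -> : flow A u 0 = flow A (j%:R * t + s) 0 by rewrite /s addrC subrK.
  rewrite (le_trans (step _ _ _ SA s0))// -expRM_natl.
  have -> : j%:R * (k * t) = k * u - k * s by rewrite /s; ring.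
  rewrite expRD mulrC -[leRHS]mulrA ler_pM//.
  - rewrite ler_wpM2l// ler_expR ler_wpM2l// ltW//.
    exact: growth_rate_gt0 (bS SA).
  - rewrite mulrC ler_wpM2r ?expR_ge0// ler_expR.
    rewrite (le_trans (ler_norm _))// normrN normrM (ger0_norm s0).
    by rewrite ler_wpM2l.
rewrite /k lerBrDr gerDl leNgt => /negP; apply.
by rewrite divr_gt0// ln_gt0// ltr1n.
Qed.

End GrowthRate.

(** * Irreducible semigroups of flows *)

(** Take [U] of maximal dimension inside [W]; a vector of [W] outside [U] would enlarge it. This
    turns a subspace given as a predicate into one to which [irreducible] applies. *)
Lemma vspace_of_subspace (K : fieldType) (vT : vectType K) (W : vT -> Prop) :
  W 0 -> (forall x y, W x -> W y -> W (x + y)) -> (forall a x, W x -> W (a *: x)) ->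
  exists U : {vspace vT}, forall x, x \in U <-> W x.
Proof.
move=> W0 WD WZ.
pose p d := `[< exists U : {vspace vT}, \dim U = d /\ forall x, x \in U -> W x >].
have p0 : exists d, p d.
  exists 0%N; apply/asboolP; exists 0%VS; split; first exact: dimv0.
  by move=> x; rewrite memv0 => /eqP ->.
have pub d : p d -> (d <= \dim (fullv : {vspace vT}))%N.
  by move=> /asboolP[U [<- _]]; exact/dimvS/subvf.
have [d /asboolP[U [Ud UW]] dmax] := ex_maxnP p0 pub.
exists U => x; split; first exact: UW.
move=> Wx; apply: contrapT => /negP xU.
have : p (\dim (U + <[x]>)).
  apply/asboolP; exists (U + <[x]>)%VS; split=> // y /memv_addP[u uU [v vx ->]].
  by apply: WD; [exact: UW|move/vlineP : vx => [a ->]; exact: WZ].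
move=> /dmax; rewrite -Ud => /(conj (addvSl U <[x]>)) /andP.
rewrite -eqEdim => /eqP E; move/negP: xU; apply; rewrite E.
by apply: (subvP (addvSr U <[x]>)); exact: memv_line.
Qed.

Section Concatenation.
Variables (R : realType) (n : nat) (F : R -> set (R -> 'M[R]_n)).

Lemma infinite_concat_exists (tau : nat -> R) (a : nat -> R -> 'M[R]_n) :
  (forall k, 0 <= tau k) -> exists A, is_infinite_concat tau a A.
Proof.
move=> tau0.
have ser_le i j : (i <= j)%N -> series tau i <= series tau j.
  by move=> ij; apply: nondecreasing_series => // k _ _; exact: tau0.
(* The intervals between junction times are disjoint, so the index is unique; for positive [r] the
   default is reached only past the total duration. *)
pose ix r : nat := xget 0%N [set k | series tau k < r <= series tau k.+1].
exists (fun r => if r <= 0 then a 0%N r else a (ix r) (r - series tau (ix r))).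
split=> [r ->//|k r rk].
have r0 : 0 < r.
  case/andP: rk => kr _; apply: le_lt_trans kr.
  by have := ser_le 0%N k isT; rewrite /series /= big_geq.
rewrite leNgt r0 /=; suff -> : ix r = k by [].
rewrite /ix; case: xgetP => [j _ /= rj|/(_ k)//].
case/andP: rk => k1 k2; case/andP: rj => j1 j2.
case: (ltngtP j k) => // [jk|kj].
  by have := lt_le_trans k1 (le_trans j2 (ser_le _ _ jk) : r <= series tau k); rewrite ltxx.
by have := lt_le_trans j1 (le_trans k2 (ser_le _ _ kj) : r <= series tau j); rewrite ltxx.
Qed.

(** [A] is followed by copies of [B], whose positive duration makes the total time infinite. Thus
    every flow of [F] is the flow of a signal of [infinite_concats F]. *)
Lemma infinite_concat_extends s t A B : 0 <= s -> 0 < t -> F s A -> F t B ->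
  exists2 A', infinite_concats F A' & forall r, 0 < r <= s -> A' r = A r.
Proof.
move=> s0 t0 FA FB.
pose tau k : R := if k is 0%N then s else t.
pose a k := if k is 0%N then A else B.
have tau0 k : 0 <= tau k by case: k => // k; exact: ltW.
have [A' A'P] := infinite_concat_exists a tau0; exists A'.
  exists tau, a; split=> //; first by case=> [|k]; split=> //; exact: ltW.
  have ser k : series tau k.+1 = s + k%:R * t.
    elim: k => [|k ih]; first by rewrite /series /= big_nat1 mul0r addr0.
    by rewrite seriesSr ih -natr1 mulrDl mul1r addrA.
  apply/cvgryPge => x; exists (Num.bound (x / t)).+1 => // -[//|k] /= kx.
  rewrite ser (@le_trans _ _ (k%:R * t)) ?lerDr// -ler_pdivrMr//.
  have [x0|x0] := leP 0 (x / t); last by rewrite (le_trans (ltW x0)).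
  by rewrite (le_trans (ltW (archi_boundP x0)))// ler_nat.
move=> r /andP[r0 rs].
have -> := A'P.2 0%N r; first by rewrite /series /= big_geq// subr0.
by rewrite /series /= big_geq// big_nat1 r0.
Qed.

End Concatenation.

(** If the inverses were unbounded, normalising them would give in the limit a [W] of norm 1 with
    [L *m W = 0] for some [L] in [Ks], which is invertible. *)
Lemma compact_invmx_bounded (R : realType) n (Ks : set 'M[R]_n) :
  compact Ks -> (forall K, Ks K -> K \in unitmx) ->
  exists2 g : R, 0 < g & forall K, Ks K -> `|invmx K| <= g.
Proof.
move=> cK uK; have [U [UU Uoo]] := free_ultrafilter.
have [B [_ KB]] := compact_bounded cK.
have clK : closed Ks by apply: compact_closed => //; exact: norm_hausdorff.
apply: contrapT => ng.
have H k : exists K, Ks K /\ k.+1%:R < `|invmx K|.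
  apply: contrapT => nk; apply: ng; exists k.+1%:R => // K KsK.
  by rewrite leNgt; apply/negP => lt; apply: nk; exists K.
have [K KP] := choice H.
have ik0 k : 0 < `|invmx (K k)| by apply: lt_trans (KP k).2.
pose V k := `|invmx (K k)|^-1 *: invmx (K k).
have V1 k : `|V k| = 1.
  by rewrite normrZ ger0_norm ?invr_ge0// mulVf// gt_eqF.
have [|L KL] := @ultra_cvg_mx R U UU _ _ K (B + 1).
  by move=> k; apply: (KB (B + 1)); [rewrite ltrDl|exact: (KP k).1].
have [|W VW] := @ultra_cvg_mx R U UU _ _ V 1; first by move=> k; rewrite V1.
have KsL : Ks L.
  apply: (@closed_cvg _ _ U _ K Ks clK _ L KL).
  by apply: nearW => k; exact: (KP k).1.
have W1 : `|W| = 1.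
  apply: (@cvg_unique _ _ (`|V k| @[k --> U])) => //; first exact: cvg_norm.
  rewrite (_ : (fun k => `|V k|) = fun=> 1); first exact: cvg_cst.
  by apply/funext => k; rewrite V1.
have LW : L *m W = 0.
  apply: (@cvg_unique _ (@norm_hausdorff _ _) ((K k *m V k) @[k --> U])).
    exact: cvg_mulmx.
  apply/cvgr0Pnorm_le => e e0; apply: Uoo.
  have : \forall k \near \oo, `|@harmonic R k| <= e.
    by move/cvgr0Pnorm_le : (@cvg_harmonic R); exact.
  move=> [m _ mP]; exists m => // k /mP /=; rewrite ger0_norm//; apply: le_trans.
  have -> : K k *m V k = `|invmx (K k)|^-1 *: 1%:M.
    by rewrite /V -scalemxAr mulmxV// uK//; exact: (KP k).1.
  rewrite normrZ ger0_norm ?invr_ge0//.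
  apply: (@le_trans _ _ (`|invmx (K k)|^-1 * 1)).
    by rewrite ler_wpM2l ?invr_ge0// mx_norm1.
  by rewrite mulr1 lef_pV2 ?posrE// ltW// (KP k).2.
have : W = 0 by rewrite -(mulKmx (uK _ KsL) W) LW mulmx0.
by move=> W0; move/eqP: W1; rewrite W0 normr0 eq_sym oner_eq0.
Qed.

Section Irreducible.
Variables (R : realType) (n : nat) (F : R -> set (R -> 'M[R]_n)) (c : R).
Hypothesis bF : forall t A, 0 <= t -> F t A -> bounded_signal c A.
Hypothesis catF : concatenable F.

Lemma flows_at_mul s t P Q : 0 <= s -> 0 <= t ->
  flows_at F s P -> flows_at F t Q -> flows_at F (s + t) (Q *m P).
Proof.
move=> s0 t0 [A FA <-] [B FB <-]; exists (concat s A B); first exact: catF.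
by apply: (@flow_concat _ _ _ _ c) => //; [exact: bF FA|exact: bF FB].
Qed.

Lemma flows_at_unitmx t P : 0 <= t -> flows_at F t P -> P \in unitmx.
Proof. by move=> t0 [A FA <-]; apply: flow_unitmx t0 (bF t0 FA). Qed.

(** The vectors sent to 0 by every [Q *m P] form a subspace invariant under the semigroup. If it is
    the whole space, then [Q *m P0 = 0] with [P0] invertible. *)
Lemma irreducible_nonvanishing (Q : 'M[R]_n) (x : 'cV[R]_n) :
  irreducible (flows F) -> flows F !=set0 ->
  (forall P, flows F P -> Q *m P *m x = 0) -> x = 0 \/ Q = 0.
Proof.
move=> irr [P0 FP0] Qx.
have [|||U UW] := @vspace_of_subspace R 'cV[R]_n
  (fun y => forall P, flows F P -> Q *m P *m y = 0).
- by move=> P _; rewrite mulmx0.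
- by move=> y z yP zP P FP; rewrite mulmxDr yP// zP// addr0.
- by move=> a y yP P FP; rewrite -scalemxAr yP// scaler0.
have inv P y : flows F P -> y \in U -> P *m y \in U.
  move=> FP /UW yW; apply/UW => P' FP'; rewrite mulmxA -[Q *m P' *m P]mulmxA.
  case: FP => t /= + FP; rewrite in_itv/= andbT => t0.
  case: FP' => t' /= + FP'; rewrite in_itv/= andbT => t'0.
  apply: yW; exists (t + t') => /=; first by rewrite in_itv/= andbT addr_ge0.
  exact: flows_at_mul.
have [U0|U1] := irr U inv; [left|right].
  by apply/eqP; rewrite -memv0 -U0; apply/UW.
have P0u : P0 \in unitmx.
  by case: FP0 => t /=; rewrite in_itv/= andbT => t0; exact: flows_at_unitmx.
suff : Q *m P0 = 0 by move=> /(congr1 (fun X => X *m invmx P0)); rewrite mulmxK// mul0mx.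
apply/matrixP => i j; rewrite [RHS]mxE.
have := (UW (delta_mx j 0)).1; rewrite U1 memvf => /(_ isT P0 FP0).
by move=> /matrixP/(_ i 0); rewrite -colE !mxE.
Qed.

(** Compactness: counterexamples for horizons [t0 + k] and constants [k.+1%:R^-1], normalised,
    converge to [Q] and [x] of norm 1 with [Q *m P *m x = 0] for every [P], whatever its
    duration. *)
Lemma irreducible_uniform : irreducible (flows F) -> flows F !=set0 ->
  exists T d : R, [/\ 0 <= T, 0 < d & forall (Q : 'M[R]_n) (x : 'cV[R]_n),
    exists t P, [/\ 0 <= t <= T, flows_at F t P &
      d * `|Q| * `|x| <= `|Q *m P *m x|]].
Proof.
move=> irr Fn0; have [P0 [t0 /= + FP0]] := Fn0; rewrite in_itv/= andbT => t00.
have [U [UU Uoo]] := free_ultrafilter.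
apply: contrapT => nex.
(* Horizons start at the duration [t0] of some flow [P0]: the strict inequality at [P0] forces [Q]
   and [x] to be nonzero, so they can be normalised. *)
have H k : exists Qx : 'M[R]_n * 'cV[R]_n, [/\ `|Qx.1| = 1, `|Qx.2| = 1 &
    forall t P, 0 <= t <= t0 + k%:R -> flows_at F t P ->
      `|Qx.1 *m P *m Qx.2| <= k.+1%:R^-1].
  apply: contrapT => nk; apply: nex; exists (t0 + k%:R), k.+1%:R^-1.
  split; [by rewrite addr_ge0|by []|move=> Q x].
  apply: contrapT => nt; apply: nk.
  have small t P : 0 <= t <= t0 + k%:R -> flows_at F t P ->
      `|Q *m P *m x| < k.+1%:R^-1 * `|Q| * `|x|.
    by move=> tk FP; rewrite ltNge; apply/negP => h; apply: nt; exists t, P.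
  have pos : 0 < k.+1%:R^-1 * `|Q| * `|x|.
    have h : 0 <= t0 <= t0 + k%:R by rewrite t00 lerDl ler0n.
    by apply: le_lt_trans (small t0 P0 h FP0).
  have xn0 : `|x| != 0 by apply: contraTneq pos => ->; rewrite mulr0 ltxx.
  have Qn0 : `|Q| != 0 by apply: contraTneq pos => ->; rewrite mulr0 mul0r ltxx.
  exists (`|Q|^-1 *: Q, `|x|^-1 *: x); split=> /=.
  - by rewrite normrZ ger0_norm ?invr_ge0// mulVf.
  - by rewrite normrZ ger0_norm ?invr_ge0// mulVf.
  - move=> t P tk FP.
    have -> : `|Q|^-1 *: Q *m P *m (`|x|^-1 *: x) =
        (`|Q| * `|x|)^-1 *: (Q *m P *m x).
      by rewrite -!scalemxAl -scalemxAr scalerA invfM.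
    rewrite normrZ ger0_norm ?invr_ge0 ?mulr_ge0// ler_pdivrMl; last first.
      by rewrite mulr_gt0// lt_def ?Qn0 ?xn0 normr_ge0.
    by have := ltW (small t P tk FP); rewrite -mulrA mulrC.
have [Qx QxP] := choice H.
have [|Q QL] := @ultra_cvg_mx R U UU _ _ (fun k => (Qx k).1) 1.
  by move=> k; have [-> _ _] := QxP k.
have [|x xL] := @ultra_cvg_mx R U UU _ _ (fun k => (Qx k).2) 1.
  by move=> k; have [_ -> _] := QxP k.
have lim1 m p (X : nat -> 'M[R]_(m, p)) L : (forall k, `|X k| = 1) ->
    X @ U --> L -> `|L| = 1.
  move=> X1 XL; apply: (@cvg_unique _ _ (`|X k| @[k --> U])) => //.
    exact: cvg_norm.
  rewrite (_ : (fun k => `|X k|) = fun=> 1); first exact: cvg_cst.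
  by apply/funext => k; rewrite X1.
have Q1 : `|Q| = 1 by apply: lim1 QL => k; have [] := QxP k.
have x1 : `|x| = 1 by apply: lim1 xL => k; have [] := QxP k.
have : x = 0 \/ Q = 0.
  apply: irreducible_nonvanishing => // P [t /= + FP]; rewrite in_itv/= andbT => tge0.
  apply: (@cvg_unique _ (@norm_hausdorff _ _) (((Qx k).1 *m P *m (Qx k).2) @[k --> U])).
    by apply: cvg_mulmx => //; apply: cvg_mulmx => //; exact: cvg_cst.
  apply/cvgr0Pnorm_le => e e0; apply: Uoo.
  have : \forall k \near \oo, `|@harmonic R k| <= e.
    by move/cvgr0Pnorm_le : (@cvg_harmonic R); exact.
  move=> [m _ mP]; exists (maxn m (Num.bound t)) => // k /=; rewrite geq_max => /andP[mk tk].
  have := mP k mk; rewrite /= ger0_norm//; apply: le_trans.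
  have [_ _ h] := QxP k; apply: (h t P _ FP).
  apply/andP; split=> //; rewrite (@le_trans _ _ k%:R) ?lerDr//.
  by rewrite (le_trans (ltW (archi_boundP tge0)))// ler_nat.
by case=> E; [move: x1|move: Q1]; rewrite E normr0 => /eqP; rewrite eq_sym oner_eq0.
Qed.

End Irreducible.

(** * Upper and lower exponential bounds on trajectories *)

Section QuasiExtremal.
Variables (R : realType) (n : nat) (N : 'cV[R]_n -> R).
Variables (S : set (R -> 'M[R]_n)) (F : R -> set (R -> 'M[R]_n)) (c : R).
Hypothesis n0 : (0 < n)%N.
Hypothesis nN : is_norm N.
Hypothesis bS : forall A, S A -> bounded_signal c A.
Hypothesis S0 : S !=set0.
Hypothesis bF : forall t A, 0 <= t -> F t A -> bounded_signal c A.
Hypothesis shS : shift_invariant S.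
Hypothesis catF : concatenable F.
Hypothesis irr : irreducible (flows F).
Hypothesis fatSF : fat N S F.

Local Notation la := (ln (rho N S)).

Let FS : infinite_concats F `<=` S. Proof. by case: fatSF. Qed.

Let F_late T : exists t A, T <= t /\ F t A.
Proof.
have [_ [C [D [Ks [_ _ _ _ H]]]]] := fatSF; have [A SA] := S0.
have T0 : 0 <= Num.max 0 T by rewrite le_max lexx.
have [K [t [Q [_ /andP[Tt _] [B FB _] _ _]]]] := H _ _ T0 SA.
by exists t, B; split=> //; apply: le_trans Tt; rewrite le_max lexx orbT.
Qed.

Let extends s Q : 0 <= s -> flows_at F s Q ->
  exists2 A, infinite_concats F A & flow A s 0 = Q.
Proof.
move=> s0 [A FA <-]; have [t [B [t1 FB]]] := F_late 1.
have t0 : 0 < t by exact: lt_le_trans t1.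
have [A' FA' A'A] := infinite_concat_extends s0 t0 FA FB.
exists A'; first exact: FA'.
exact: (eq_flow s0 (bS (FS FA')) (bF s0 FA) A'A).
Qed.

Let F_ne : flows F !=set0.
Proof.
have [t [A [t1 FA]]] := F_late 0.
by exists (flow A t 0), t; [rewrite /= in_itv/= t1|exists A].
Qed.

Lemma flows_growth : exists2 C, 0 < C &
  forall t Q, 0 <= t -> flows_at F t Q -> `|Q| <= C * expR (la * t).
Proof.
have [T [d [T0 d0 TdP]]] := irreducible_uniform bF catF irr F_ne.
(* The summand 1 serves durations equal to 0, where the flow is the identity and repeated words
   would not get longer. *)
pose C := 1 + expR (`|la| * T) / d.
have eT : 0 < expR (`|la| * T) / d by rewrite divr_gt0// expR_gt0.
have C1 : 1 <= C by rewrite lerDl ltW.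
exists C; first exact: lt_le_trans C1.
move=> t Q; rewrite le_eqVlt => /predU1P[<- [A FA <-]|t0 FQ].
  rewrite (flow0 (bF (lexx 0) FA)) mulr0 expR0 mulr1 (le_trans _ C1)//.
  exact: mx_norm1.
suff : d * `|Q| <= expR (la * t + `|la| * T).
  rewrite expRD -ler_pdivlMl// => /le_trans; apply.
  rewrite mulrC -mulrA mulrC ler_wpM2r ?expR_ge0// /C lerDr.
  by rewrite ler01.
rewrite leNgt; apply/negP => big.
have dQ0 : 0 < d * `|Q| by apply: lt_trans big; exact: expR_gt0.
(* One block [Q *m P] gains at least [m] in log-norm, whereas [v] bounds [la] times its duration
   whatever the sign of [la]. The assumption [big] says that [v < m]. *)
pose m := ln (d * `|Q|); pose v := la * t + `|la| * T.
have vm : v < m by rewrite -ltr_expR /m lnK.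
pose x : 'cV[R]_n := const_mx 1.
have x1 : `|x| = 1.
  apply/eqP; rewrite eq_le; apply/andP; split.
    by apply: mx_norm_le => // i j; rewrite mxE normr1.
  by have := mx_norm_entry x (Ordinal n0) 0; rewrite mxE normr1.
have words j : exists s W, [/\ j.+1%:R * t <= s <= j.+1%:R * (t + T),
    flows_at F s W & expR (m * j.+1%:R) <= `|W *m x|].
  elim: j => [|j [s [W [/andP[js sj] FW Wx]]]].
    have [s [P [/andP[s0 sT] FP]]] := TdP Q x.
    rewrite x1 mulr1 => h; exists (s + t), (Q *m P); split.
    - by rewrite !mul1r lerDr s0 addrC lerD2l.
    - by apply: (flows_at_mul bF catF) => //; exact: ltW.
    - by rewrite mulr1 lnK.
  have s0 : 0 <= s by apply: le_trans js; rewrite mulr_ge0// ltW.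
  have [s' [P [/andP[s'0 s'T] FP h]]] := TdP Q (W *m x).
  exists (s + s' + t), (Q *m (P *m W)); split.
  - by rewrite -natr1 !mulrDl !mul1r; apply/andP; split; lra.
  - apply: (flows_at_mul bF catF) => //; [exact: addr_ge0|exact: ltW|].
    exact: (flows_at_mul bF catF).
  - rewrite !mulmxA in h *; apply: le_trans h.
    rewrite -[j.+2%:R]natr1 mulrDr mulr1 expRD mulrC.
    by rewrite {1}/m lnK ?posrE// ler_wpM2l// ltW.
(* The surplus [m - v] of a block is spread over its duration, at most [t + T]; long words then grow
   at the rate [k > la], which contradicts [ln_rho_ge]. *)
pose k := la + (m - v) / (t + T).
have tT : 0 < t + T by rewrite ltr_wpDr.
have : k <= la.
  apply: (ln_rho_ge n0 nN bS S0 (b := n%:R^-1)) => [|X]; first by rewrite invr_gt0 ltr0n.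
  pose j := Num.bound (Num.max 0 X / t).
  have [s [W [/andP[js sj] FW Wx]]] := words j.
  have s0 : 0 <= s by apply: le_trans js; rewrite mulr_ge0// ltW.
  have [A FA AW] := extends s0 FW.
  exists s, A; split; [|exact: FS|].
    apply: (@le_lt_trans _ _ (Num.max 0 X)); first by rewrite le_max lexx orbT.
    rewrite (lt_le_trans _ js)// -ltr_pdivrMr//.
    apply: (@lt_trans _ _ j%:R); last by rewrite ltr_nat.
    by apply: archi_boundP; rewrite divr_ge0 ?le_max ?lexx// ltW.
  rewrite AW ler_pdivrMl ?ltr0n//.
  have := mx_norm_mul W x; rewrite x1 mulr1; apply: le_trans.
  apply: le_trans Wx; rewrite ler_expR /k mulrDl.
  have -> : m * j.+1%:R = v * j.+1%:R + (m - v) * j.+1%:R by ring.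
  apply: lerD.
    have : la * (s - j.+1%:R * t) <= `|la| * (j.+1%:R * T).
      apply: (@le_trans _ _ (`|la| * (s - j.+1%:R * t))).
        by rewrite ler_wpM2r ?subr_ge0// ler_norm.
      by rewrite ler_wpM2l// lerBlDl -mulrDr.
    rewrite /v; lra.
  rewrite mulrAC ler_pdivrMr// -mulrA ler_wpM2l ?subr_ge0 ?(ltW vm)//.
rewrite leNgt => /negP; apply.
by rewrite ltrDl divr_gt0// subr_gt0.
Qed.

(** Writes [flow A t 0] as [B *m Q *m invmx K], where fatness bounds [B] and compactness of [Ks]
    bounds the last factor. *)
Let S_le_flows : exists C D : R, [/\ 0 < C, 0 <= D & forall A t, S A -> 0 <= t ->
  exists s Q, [/\ t <= s <= t + D, flows_at F s Q & `|flow A t 0| <= C * `|Q|]].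
Proof.
have [_ [C [D [Ks [C0 D0 cK uK H]]]]] := fatSF.
have [g g0 gK] := compact_invmx_bounded cK uK.
have [a a1 [_ aP]] := norm_equivalence nN.
exists (n%:R * (n%:R * (a * C + 1)) * g), D; split=> //.
  rewrite !mulr_gt0 ?ltr0n// ltr_wpDl// mulr_ge0//.
  exact: le_trans a1.
move=> A t SA t0; have [K [s [Q [KsK ts FQ le _]]]] := H t A t0 SA.
have s0 : 0 <= s by case/andP : ts => ts _; exact: le_trans ts.
exists s, Q; split=> //.
have uQ : Q \in unitmx by exact: flows_at_unitmx bF _ _ s0 FQ.
set B := flow A t 0 *m K *m invmx Q in le.
have -> : flow A t 0 = B *m Q *m invmx K by rewrite /B mulmxKV// mulmxK// uK.
have BC : `|B| <= a * C + 1.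
  rewrite (le_trans (aP _).2)// (@le_trans _ _ (a * C)) ?lerDl//.
  by rewrite ler_wpM2l// (le_trans _ a1).
rewrite (le_trans (mx_norm_mul _ _))//.
apply: (@le_trans _ _ (n%:R * (n%:R * (a * C + 1) * `|Q|) * g)).
  apply: ler_pM => //; last exact: gK.
  rewrite ler_wpM2l// (le_trans (mx_norm_mul _ _))// ler_wpM2r//.
  by rewrite ler_wpM2l.
by rewrite le_eqVlt; apply/orP; left; apply/eqP; ring.
Qed.

Let expR_window (t s D : R) : `|s - t| <= D ->
  expR (la * s) <= expR (`|la| * D) * expR (la * t).
Proof.
move=> sD; rewrite -expRD ler_expR -lerBlDr -mulrBr.
rewrite (le_trans (ler_norm _))// normrM ler_wpM2l//.
Qed.

Let S_growth : exists2 C, 0 < C &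
  forall A t, S A -> 0 <= t -> `|flow A t 0| <= C * expR (la * t).
Proof.
have [C1 C10 h1] := flows_growth; have [C2 [D [C20 D0 h2]]] := S_le_flows.
exists (C2 * (C1 * expR (`|la| * D))).
  by rewrite !mulr_gt0// expR_gt0.
move=> A t SA t0; have [s [Q [/andP[ts st] FQ le]]] := h2 A t SA t0.
rewrite (le_trans le)// -mulrA ler_wpM2l ?(ltW C20)//.
rewrite (le_trans (h1 s Q _ FQ))//; first exact: le_trans ts.
rewrite -mulrA ler_wpM2l ?(ltW C10)// expR_window//.
by rewrite ger0_norm ?subr_ge0// lerBlDl.
Qed.

Lemma finite_horizon_trajectory : exists2 d, 0 < d &
  forall (x : 'cV[R]_n) (T : R), 0 < T -> exists2 A, infinite_concats F A &
    forall t, 0 <= t <= T -> d * expR (la * t) * `|x| <= `|flow A t 0 *m x|.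
Proof.
have [C2 [D [C20 D0 h2]]] := S_le_flows; have [C3 C30 h3] := S_growth.
have [T1 [d [T10 d0 h1]]] := irreducible_uniform bF catF irr F_ne.
have nR : 0 < n%:R :> R by rewrite ltr0n.
pose E := expR (`|la| * (D + T1)).
have E0 : 0 < E by exact: expR_gt0.
(* Successive losses: irreducibility ([d]), the norm attained at time [T] and its comparison with
   [Q] ([2 * n%:R * C2]), the excess duration over [T] ([E]), and growth after time [t]
   ([n%:R * C3]). *)
pose e := d / (2 * n%:R * C2) / E / (n%:R * C3).
exists e; first by rewrite !(divr_gt0, mulr_gt0).
move=> x T T0.
have [A SA lA] := rho_attained n0 nN bS S0 shS T0.
have [s [Q [/andP[Ts sT] FQ AQ]]] := h2 A T SA (ltW T0).
(* [P] acts before [Q]: it steers [x] to a direction on which [Q] realises its norm up to the factor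
   [d]. *)
have [t1 [P [/andP[t10 t1T] FP Px]]] := h1 Q x.
have s0 : 0 <= s by exact: le_trans (ltW T0) Ts.
have FQP : flows_at F (t1 + s) (Q *m P) by exact: (flows_at_mul bF catF).
have ts0 : 0 <= t1 + s by exact: addr_ge0.
have [A' FA' A'E] := extends ts0 FQP.
exists A' => // t /andP[t0 tT].
have bA' : bounded_signal c A' by exact/bS/FS.
pose u := t1 + s - t.
have u0 : 0 <= u by rewrite subr_ge0 (le_trans tT)// (le_trans Ts)// lerDr.
(* The flow after time [t] is bounded above, so a large final vector forces a large vector at time
   [t]. *)
have A'tu : Q *m P *m x = flow (Defs.shift t A') u 0 *m (flow A' t 0 *m x).
  by rewrite mulmxA -(flow_shift t0 u0 bA') /u addrC subrK A'E.
have up : `|Q *m P *m x| <= n%:R * (C3 * expR (la * u)) * `|flow A' t 0 *m x|.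
  rewrite A'tu (le_trans (mx_norm_mul _ _))// ler_wpM2r// ler_wpM2l//.
  by apply: h3 => //; apply: shS => //; exact: FS.
have low : d / (2 * n%:R * C2) / E * expR (la * (t1 + s)) * `|x| <= `|Q *m P *m x|.
  apply: le_trans Px; rewrite ler_wpM2r//.
  have TE : expR (la * (t1 + s)) <= E * expR (la * T).
    apply: expR_window; rewrite ger0_norm; first by lra.
    by rewrite subr_ge0 (le_trans Ts)// lerDr.
  have QE : expR (la * T) <= 2 * n%:R * C2 * `|Q|.
    move: lA; rewrite ler_pdivrMr// => /le_trans; apply.
    rewrite [leRHS](_ : _ = n%:R * (C2 * `|Q|) * 2); last by ring.
    by rewrite ler_wpM2r// ler_wpM2l.
  have k0 : 0 < 2 * n%:R * C2 by rewrite !mulr_gt0.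
  rewrite (_ : d / _ / E * _ = d * (expR (la * (t1 + s)) / (2 * n%:R * C2 * E))).
    rewrite ler_wpM2l ?(ltW d0)// ler_pdivrMr ?mulr_gt0// (le_trans TE)//.
    by rewrite mulrA [leRHS]mulrC ler_wpM2l ?(ltW E0)// [leRHS]mulrC.
  by field; rewrite !gt_eqF.
have {up low} := le_trans low up.
have -> : expR (la * (t1 + s)) = expR (la * u) * expR (la * t).
  by rewrite -expRD; congr expR; rewrite /u; ring.
have eu : 0 < expR (la * u) by exact: expR_gt0.
have k1 : 0 < n%:R * C3 * expR (la * u) by rewrite !mulr_gt0.
move=> h; rewrite -(ler_pM2l k1).
have -> : n%:R * C3 * expR (la * u) * (e * expR (la * t) * `|x|) =
    d / (2 * n%:R * C2) / E * (expR (la * u) * expR (la * t)) * `|x|.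
  rewrite /e; field.
  by rewrite !gt_eqF.
by rewrite -[n%:R * C3 * _]mulrA.
Qed.

Lemma S_trajectory_le : exists2 C, 0 < C & forall A t (x : 'cV[R]_n),
  S A -> 0 <= t -> `|flow A t 0 *m x| <= C * expR (la * t) * `|x|.
Proof.
have [C C0 h] := S_growth; exists (n%:R * C).
  by rewrite mulr_gt0// ltr0n.
move=> A t x SA t0; rewrite (le_trans (mx_norm_mul _ _))// ler_wpM2r//.
by rewrite -mulrA ler_wpM2l// h.
Qed.

End QuasiExtremal.

(** * The weak-star closure *)

Section WeakStar.
Variables (R : realType) (n : nat).
Local Notation mu := (@lebesgue_measure R).
Implicit Types A B : R -> 'M[R]_n.

Lemma Linfty_bounded_signal (I : set R) (M : set 'M[R]_n) (c : R) A :
  measurable I -> 0 <= c -> (forall X, M X -> `|X| <= c) ->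
  Linfty I M A -> bounded_signal c A.
Proof.
move=> mI c0 Mc [mA _ MA A0]; split=> [i j|t].
  rewrite (_ : (fun t => A t i j) = (fun t => A t i j) \_ I).
    by apply/(measurable_restrict _ _ _) => //; rewrite setTI.
  apply/funext => t; rewrite patchE; case: ifPn => // /negP tI.
  by rewrite A0 ?mxE// => It; apply: tI; rewrite inE.
have [It|nIt] := pselect (I t); first exact/Mc/MA.
by rewrite A0// normr0.
Qed.

Lemma pairingE c A (f : {f : R -> 'M[R]_n | L1 `[0, +oo[ f}) :
  bounded_signal c A ->
  pairing A f = \sum_(i < n) \sum_(j < n)
    \int[mu]_t (((fun t => sval f t j i) \_ `[0, +oo[%classic) t * A t j i).
Proof.
move=> bA; rewrite /pairing.
have fi j i : mu.-integrable `[0, +oo[ (EFin \o (fun t => sval f t j i)).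
  exact: (svalP f j i).
have fAi j i : mu.-integrable `[0, +oo[ (EFin \o (fun t => sval f t j i * A t j i)).
  apply: (@Rintegrable_mulb R _ _ (fun t => sval f t j i) (fun t => A t j i) c) => //.
    by apply: measurable_funTS; exact: bA.1.
  by move=> t _; rewrite (le_trans (mx_norm_entry _ _ _))// bA.2.
have -> : \int[mu]_(t in `[0, +oo[) \tr ((sval f t)^T *m A t) =
    \int[mu]_(t in `[0, +oo[) (\sum_(i < n) \sum_(j < n) sval f t j i * A t j i).
  apply: eq_Rintegral => t _; rewrite /mxtrace; apply: eq_bigr => i _.
  by rewrite mxE; apply: eq_bigr => j _; rewrite mxE.
rewrite Rintegral_sum//; last first.
  by move=> i; exact: Rintegrable_sum.
apply: eq_bigr => i _; rewrite Rintegral_sum//; apply: eq_bigr => j _.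
rewrite [LHS]Rintegral_mkcond; apply: eq_Rintegral => t _.
by rewrite !patchE; case: ifP => _; rewrite ?mul0r.
Qed.

(** In the initial topology, neighbourhoods of [B] come from neighbourhoods of [pairing B] for
    pointwise convergence, so convergence on each test function is enough. *)
Lemma weakstar_closure_cvg (U : set_system nat) (UU : UltraFilter U) (c : R)
    (E : set (R -> 'M[R]_n)) (A : nat -> R -> 'M[R]_n) B :
  (forall k, E (A k)) -> (forall k, bounded_signal c (A k)) ->
  bounded_signal c B -> (forall t, ~ `[0, +oo[%classic t -> B t = 0) ->
  (forall i j g, mu.-integrable setT (EFin \o g) ->
    \int[mu]_t (g t * A k t i j) @[k --> U] --> \int[mu]_t (g t * B t i j)) ->
  weakstar_closure E B.
Proof.
move=> EA bA bB B0 AB; split.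
  split=> //.
  - by move=> i j; apply: measurable_funTS; exact: bB.1.
  - by exists c; apply: aeW => t _; exact: bB.2.
move=> V [_ [[V' V'op <-] V'B V'V]].
have ptw : {ptws, (fun k => pairing (A k)) @ U --> pairing B}.
  apply/cvg_sup => f W [_ [[W' W'op <-] W'B W'W]].
  suff : pairing (A k) f @[k --> U] --> pairing B f.
    move=> /(_ W' (open_nbhs_nbhs (conj W'op W'B))) UW'.
    by apply: (@filterS nat U _ _ _ _ UW') => k W'k; exact: W'W.
  rewrite (pairingE f bB).
  under eq_fun do rewrite (pairingE f (bA _)).
  apply: cvg_big => [|i _]; first exact: add_continuous.
  apply: cvg_big => [|j _]; first exact: add_continuous.
  apply: AB; have := svalP f j i.
  by rewrite integrable_mkcond//= restrict_EFin.
have /ptw : nbhs (pairing B : {ptws {f : R -> 'M[R]_n | L1 `[0, +oo[ f} -> R}) V'.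
  exact: open_nbhs_nbhs.
move=> /= UV; have [k Vk] := @filter_ex _ U _ _ UV.
by exists (A k); split=> //; exact: V'V.
Qed.

Lemma weakstar_sequential_limit (U : set_system nat) (UU : UltraFilter U) (c : R)
    (A : nat -> R -> 'M[R]_n) :
  (forall k, bounded_signal c (A k)) ->
  (forall k t, ~ `[0, +oo[%classic t -> A k t = 0) ->
  exists B, [/\ bounded_signal c B, forall t, ~ `[0, +oo[%classic t -> B t = 0 &
    forall i j g, mu.-integrable setT (EFin \o g) ->
      \int[mu]_t (g t * A k t i j) @[k --> U] --> \int[mu]_t (g t * B t i j)].
Proof.
move=> bA A0.
have /choice[b bP] : forall ij : 'I_n * 'I_n, exists b : R -> R,
    [/\ measurable_fun setT b, forall t, `|b t| <= c &
      forall g, mu.-integrable setT (EFin \o g) ->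
        \int[mu]_t (g t * A k t ij.1 ij.2) @[k --> U] --> \int[mu]_t (g t * b t)].
  move=> [i j]; apply: (@bounded_weakstar_limit R U UU (fun k t => A k t i j)).
    by move=> k; exact: (bA k).1.
  by move=> k t; rewrite (le_trans (mx_norm_entry _ _ _))// (bA k).2.
have c0 : 0 <= c := bounded_signal_ge0 (bA 0%N).
(* The scalar limits are not controlled at negative times. Cutting them off preserves convergence
   because all [A k] vanish there, so test functions may be cut off as well. *)
pose B t : 'M[R]_n := \matrix_(i, j) ((b (i, j) \_ `[0, +oo[%classic) t).
have B0 t : ~ `[0, +oo[%classic t -> B t = 0.
  move=> t0; apply/matrixP => i j; rewrite !mxE patchE; case: ifPn => //.
  by rewrite inE.
exists B; split=> //.
  split=> [i j|t].
    rewrite (_ : (fun t => B t i j) = b (i, j) \_ `[0, +oo[%classic).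
      apply/(measurable_restrict _ _ _) => //; rewrite setTI.
      by apply: measurable_funTS; have [] := bP (i, j).
    by apply/funext => t; rewrite mxE.
  apply: mx_norm_le => // i j; rewrite mxE patchE; case: ifP => _.
    by have [_ + _] := bP (i, j); apply.
  by rewrite normr0.
move=> i j g gi; pose g' := g \_ `[0, +oo[%classic.
have g'i : mu.-integrable setT (EFin \o g').
  have : mu.-integrable `[0, +oo[ (EFin \o g) by exact: integrableS gi.
  by rewrite integrable_mkcond//= restrict_EFin.
have [_ _ /(_ g' g'i) /=] := bP (i, j).
have -> : \int[mu]_t (g t * B t i j) = \int[mu]_t (g' t * b (i, j) t).
  apply: eq_Rintegral => t _; rewrite mxE /g' !patchE.
  by case: ifP => _; rewrite ?mul0r ?mulr0.
have H k : \int[mu]_t (g t * A k t i j) = \int[mu]_t (g' t * A k t i j).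
  apply: eq_Rintegral => t _; rewrite /g' patchE; case: ifPn => // tn.
  by rewrite A0 ?mxE ?mulr0 ?mul0r// => It; move/negP : tn; apply; rewrite inE.
by under [X in _ -> X @ U --> _]eq_fun do rewrite H.
Qed.

End WeakStar.

Theorem theorem7 (R : realType) (n : nat) (N : 'cV[R]_n -> R)
    (M : set 'M[R]_n) (S : set (R -> 'M[R]_n)) (F : R -> set (R -> 'M[R]_n)) :
  is_norm N ->
  bounded_set M -> M !=set0 ->
  S `<=` Linfty `[0, +oo[ M -> S !=set0 ->
  (forall t, 0 <= t -> F t `<=` Linfty `[0, t] M) ->
  shift_invariant S ->
  concatenable F ->
  irreducible (flows F) ->
  fat N S F ->
  exists C : R, 1 <= C /\
    forall x0 : 'cV[R]_n, x0 != 0 ->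
      exists A, weakstar_closure (infinite_concats F) A /\
        forall t : R, 0 <= t ->
          C^-1 * rho N S `^ t * N x0 <= N (flow A t 0 *m x0) <= C * rho N S `^ t * N x0.
Proof.
move=> nN bM Mn SL Sn FL shS catF irr fatSF.
(* In dimension 0 there is no nonzero vector. *)
have [n0|n0] := leqP n 0.
  exists 1; split=> // x0 /eqP[]; apply/matrixP => i.
  by have := ltn_ord i; rewrite [X in (_ < X)%N](_ : n = 0)%N//; apply/eqP; rewrite -leqn0.
have [c c0 Mc] : exists2 c : R, 0 <= c & forall X, M X -> `|X| <= c.
  have [b [_ bP]] := bM; exists (`|b| + 1); first by rewrite addr_ge0.
  by move=> X MX; apply: (bP (`|b| + 1)) => //; rewrite (le_lt_trans (ler_norm _))// ltrDl.
have bS A : S A -> bounded_signal c A.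
  by move=> /SL; apply: Linfty_bounded_signal.
have bF t A : 0 <= t -> F t A -> bounded_signal c A.
  by move=> t0 /(FL t t0); apply: Linfty_bounded_signal.
have [a a1 [aN _]] := norm_equivalence nN.
have a0 : 0 < a by exact: lt_le_trans a1.
have [d d0 low] := finite_horizon_trajectory n0 nN bS Sn bF shS catF irr fatSF.
have [C C0 up] := S_trajectory_le n0 nN bS Sn bF catF irr fatSF.
have FS : infinite_concats F `<=` S by case: fatSF.
(* Each bound for the max norm costs a factor [a] at either end when transferred to [N]; the summand
   1 ensures [1 <= K]. *)
pose K := 1 + a * a * C + a * a / d.
have aC : 0 < a * a * C by rewrite !mulr_gt0.
have ad : 0 < a * a / d by rewrite divr_gt0// mulr_gt0.
have K1 : 1 <= K by rewrite /K -addrA lerDl addr_ge0// ltW.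
exists K; split=> // x _.
have [U [UU Uoo]] := free_ultrafilter.
(* A single sequence with horizons tending to infinity, and one ultrafilter, give a limit signal
   independent of [t]. *)
have /choice[A AP] : forall k : nat, exists A, infinite_concats F A /\
    forall t, 0 <= t <= k.+1%:R ->
      d * expR (ln (rho N S) * t) * `|x| <= `|flow A t 0 *m x|.
  by move=> k; have [A FA AP] := low x k.+1%:R (ltr0Sn _ k); exists A.
have bA k : bounded_signal c (A k) by exact/bS/FS/(AP k).1.
have A0 k t : ~ `[0, +oo[%classic t -> A k t = 0.
  by have [_ _ _] := SL _ (FS _ (AP k).1); apply.
have [B [bB B0 AB]] := @weakstar_sequential_limit R n U UU c A bA A0.
exists B; split.
  by apply: (@weakstar_closure_cvg R n U UU c _ A) => // k; exact: (AP k).1.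
move=> t t0.
have cvx : `|flow (A k) t 0 *m x| @[k --> U] --> `|flow B t 0 *m x|.
  apply: cvg_norm; apply: cvg_mulmx; last exact: cvg_cst.
  exact: (flow_cvg UU t0 bA bB AB).
have rhoE := powR_rho n0 nN bS Sn t.
set r := rho N S `^ t; have r0 : 0 <= r by exact: powR_ge0.
have lowB : d * r * `|x| <= `|flow B t 0 *m x|.
  (* At a fixed [t] the lower bound holds once the horizon [k.+1%:R] exceeds [t], hence for almost
     all [k] along [U]. *)
  apply: (cvgr_to_ge cvx); apply: Uoo; exists (Num.bound t) => // k /= tk.
  rewrite /r rhoE; apply: (AP k).2; rewrite t0 /= (le_trans (ltW (archi_boundP t0)))//.
  by rewrite ler_nat (leq_trans tk).
have upB : `|flow B t 0 *m x| <= C * r * `|x|.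
  apply: (cvgr_to_le cvx); apply: nearW => k.
  by rewrite /r rhoE; apply: up => //; exact/FS/(AP k).1.
have [x1 x2] := aN x; have [y1 y2] := aN (flow B t 0 *m x).
apply/andP; split.
  rewrite -mulrA ler_pdivrMl ?(lt_le_trans ltr01)//.
  apply: (@le_trans _ _ (a * a / d * N (flow B t 0 *m x))); last first.
    by rewrite ler_wpM2r ?is_norm_ge0// /K lerDr addr_ge0// ltW.
  rewrite mulrAC ler_pdivlMr// -[leRHS]mulrA.
  apply: (@le_trans _ _ (a * (d * r * `|x|))); last first.
    by rewrite ler_wpM2l ?(ltW a0)// (le_trans lowB).
  rewrite (_ : a * _ = r * (a * `|x|) * d); last by ring.
  by rewrite ler_wpM2r ?(ltW d0)// ler_wpM2l.
rewrite (le_trans y1)//.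
apply: (@le_trans _ _ (a * a * C * (r * N x))); last first.
  rewrite -[leRHS]mulrA ler_wpM2r ?mulr_ge0 ?is_norm_ge0// /K -addrA addrCA lerDl.
  by rewrite addr_ge0// ltW.
rewrite -!mulrA ler_wpM2l ?(ltW a0)// (le_trans upB)//.
rewrite (_ : a * _ = C * r * (a * N x)); last by ring.
by rewrite ler_wpM2l ?mulr_ge0// ltW.
Qed.
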